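(* For any initial composition $(\alpha,\beta)\in\mathbb N^2\setminus\{(0,0)\}$, the distribution of the limit $W^{DT}_{(\alpha,\beta)}$ of a large two-color discrete time Pólya urn process admits a bounded and continuous density, and its support is the whole real line $\mathbb R$.
   Context: Standing assumptions on the urn: $a,b,c,d$ are nonnegative integers with $a+b=c+d=:S$ (balanced), $bc\neq0$ (non triangular), $m:=a-c=d-b$, $\sigma:=m/S$, and the urn is large, i.e. $\sigma>\frac12$. Discrete time urn: start with $\alpha$ red and $\beta$ black balls, $(\alpha,\beta)\in\mathbb N^2\setminus\{(0,0)\}$. At each time step a ball is drawn uniformly at random among the balls of the urn and put back; if it is red, $a$ red and $b$ black balls are added; if it is black, $c$ red and $d$ black balls are added. $U^{DT}_{(\alpha,\beta)}(n)\in\mathbb N^2$ is the composition vector (number of red balls, number of black balls) after $n$ draws. Let $u_2(x,y)=\frac1S(bx-cy)$. It is known that the limit $$W^{DT}_{(\alpha,\beta)}:=\lim_{n\to+\infty}\frac1{n^{\sigma}}u_2\left(U^{DT}_{(\alpha,\beta)}(n)\right)$$ exists almost surely and in $L^p$ for every $p\ge1$. *)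

(* Defs.v *)
From HB Require Import structures.
From mathcomp Require Import all_boot all_order all_algebra.
From mathcomp Require Import all_classical all_reals all_analysis.

Set Implicit Arguments.
Unset Strict Implicit.
Unset Printing Implicit Defensive.

Import Order.TTheory GRing.Theory Num.Theory.
Import numFieldNormedType.Exports.

Local Open Scope classical_set_scope.
Local Open Scope ring_scope.

(* An urn composition is a pair (number of red balls, number of black balls).
   The balls of an urn of composition u are labelled by 'I_(u.1 + u.2), the
   red ones being those whose label is smaller than u.1. *)
Definition urn_step (a b c d : nat) (u : nat * nat) (k : 'I_(u.1 + u.2)) :
    nat * nat :=
  if (k < u.1)%N then (u.1 + a, u.2 + b)%N else (u.1 + c, u.2 + d)%N.

(* Probability that u becomes v when a ball is drawn uniformly at random:
   number of favourable balls over number of balls. *)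
Definition urn_trans (R : realType) (a b c d : nat) (u v : nat * nat) : R :=
  #|[set k : 'I_(u.1 + u.2) | urn_step a b c d k == v]%SET|%:R
  / (u.1 + u.2)%:R.

(* U is a version of the urn process: it starts almost surely at
   (alpha, beta) and, conditionally on the whole past U 0, ..., U n, the
   composition U n.+1 comes from a uniform draw in U n. The conditional
   probability is written in product form, so that histories of probability
   zero need no special treatment. *)
Definition is_urn_process d0 (T : measurableType d0) (R : realType)
    (P : probability T R) (a b c d alpha beta : nat)
    (U : nat -> {RV P >-> (nat * nat)%type}) : Prop :=
  P (U 0%N @^-1` [set (alpha, beta)]) = 1%E /\
  forall (n : nat) (h : nat -> nat * nat),
    P (\bigcap_(i in `I_n.+2) (U i @^-1` [set h i])) =
    (P (\bigcap_(i in `I_n.+1) (U i @^-1` [set h i]))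
     * (urn_trans R a b c d (h n) (h n.+1))%:E)%E.

Definition urn_sigma (R : realType) (a b c : nat) : R :=
  (a%:R - c%:R) / (a + b)%:R.

Definition urn_u2 (R : realType) (a b c : nat) (u : nat * nat) : R :=
  (a + b)%:R^-1 * (b%:R * u.1%:R - c%:R * u.2%:R).

(* W is the almost sure limit of u2 (U n) / n ^ sigma. *)
Definition is_urn_limit d0 (T : measurableType d0) (R : realType)
    (P : probability T R) (a b c : nat)
    (U : nat -> {RV P >-> (nat * nat)%type}) (W : {RV P >-> R}) : Prop :=
  {ae P, forall w, (fun n : nat =>
    (n%:R `^ urn_sigma R a b c)^-1 * urn_u2 R a b c (U n w)) @ \oo --> W w}.

Definition is_density (R : realType)
    (mu : set R -> \bar R) (f : R -> R) : Prop :=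
  [/\ measurable_fun setT f, (forall x, 0 <= f x) &
    forall A : set R, measurable A ->
      mu A = (\int[lebesgue_measure]_(x in A) (f x)%:E)%E].

(* Topological support: the points all of whose open neighbourhoods have
   positive measure. *)
Definition measure_support (R : realType) (mu : set R -> \bar R) : set R :=
  [set x | forall V : set R, open V -> V x -> (0 < mu V)%E].

(* Main.v *)
Require Import Defs.
From HB Require Import structures.
From mathcomp Require Import all_boot all_order all_algebra.
From mathcomp Require Import all_classical all_reals all_analysis.
From mathcomp Require Import measurable_realfun zify ring lra.

(** Write a = c + m and d = b + m with m > 0, and S = a + b, so that sigma is
s = m / S. After n draws, k of which are red, the composition of the urn is
(alpha + c n + m k, beta + b n + m (n - k)). The urn is thus the Markov chain
of the number k of red draws, and the probability q_n(k) of drawing a red ball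
is affine in k, with slope s / y_n, where S y_n is the number of balls. The law
p_n of the chain satisfies
  p_{n+1}(k) = (1 - q_n(k)) p_n(k) + q_n(k-1) p_n(k-1).

Density. The two coefficients add up to 1 - s / y_n, so the supremum of p_n
decays like y_n ^ -s (red_dist_bound). Because q_n is affine, the increments
of p_n satisfy a recursion of the same form, whose coefficients add up to
1 - 2 s / y_n (red_diffS), and they decay like y_n ^ (-2 s) (red_diff_bound).
Since u2 is affine in k, the rescaled variable u2 / y_n ^ s lives on a lattice
whose step h_n is a constant times y_n ^ -s. In this scale the two bounds say
that p_n / h_n is bounded and varies in a Lipschitz way, so the distribution
functions of the rescaled variables have second-order expansions whose
constants do not depend on n, up to errors of order h_n (scaled_cdf_expand).
Such expansions survive in the limit (limit_quadratic_approx): the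
distribution function of W has a bounded Lipschitz derivative, which is the
density.

Support. Let x be real and let n be large. Some state k0 at time n has
u2 / y_n ^ s within h_n of x, because u2 ranges over an interval of length of
order n while s < 1; and this state has positive probability (red_dist_gt0).
From it, the conditional mean of u2 is multiplied by 1 + s / y_j at each draw
and thus keeps pace with y_j ^ s, whereas the conditional variance at time N
is at most a constant times y_N ^ (2 s) y_n ^ (1 - 2 s) (red_law_variance).
As s > 1/2, the last factor is small, and by the Chebyshev inequality
u2 / y_N ^ s stays close to x with conditional probability at least 1/2 for
all N >= n (scaled_visits).

The definition of the process gives the probabilities of whole histories;
summing out the past gives the transitions (urn_process_transition), hence the
law p_n (urn_process_law). The passage from the rescaled variables to their
almost sure limit W uses only that the mass of an open set cannot increase in
the limit (open_portmanteau). *)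

Set Implicit Arguments.
Unset Strict Implicit.
Unset Printing Implicit Defensive.

Import Order.TTheory GRing.Theory Num.Theory.
Import numFieldNormedType.Exports.

Local Open Scope classical_set_scope.
Local Open Scope ring_scope.

(** * Comparing real powers with products of factors 1 + s / y *)

(** Young's inequality for x ^ s and 1, with exponents 1 / s and 1 / (1 - s). *)
Lemma powR_le_tangent (R : realType) (s x : R) : 0 < s < 1 -> 0 <= x ->
  x `^ s <= 1 + s * (x - 1).
Proof.
move=> /andP[s0 s1] x0.
have := @conjugate_powR R (x `^ s) 1 s^-1 (1 - s)^-1 (powR_ge0 _ _) ler01.
rewrite !invr_gt0 !invrK subr_gt0 => /(_ s0 s1).
rewrite powR1 -powRrM divff ?gt_eqF// powRr1// !mul1r mulr1.
by move=> /(_ _)/le_trans; apply; lra.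
Qed.

Lemma powR_succ_le (R : realType) (s y : R) : 0 < s < 1 -> 0 < y ->
  (y + 1) `^ s <= y `^ s * (1 + s / y).
Proof.
move=> s01 y0; have -> : y + 1 = y * (1 + y^-1) by field; lra.
have yV : 0 < y^-1 by rewrite invr_gt0.
rewrite powRM; [|lra..].
rewrite ler_wpM2l ?powR_ge0//.
have /(powR_le_tangent s01) : 0 <= 1 + y^-1 by lra.
by rewrite addrAC subrr add0r.
Qed.

(** The tangent bound for (y + 1) ^ s costs a factor 1 + s / y, and
(1 + s / y) (1 - s / y) <= 1. The same product closes [powR_pred_le]. *)
Lemma powR_succ_ge (R : realType) (s y : R) : 0 < s < 1 -> 0 < y ->
  (y + 1) `^ s * (1 - s / y) <= y `^ s.
Proof.
move=> s01 y0; have [le|gt] := leP (s / y) 1; last first.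
  apply: le_trans (powR_ge0 _ _).
  by rewrite mulr_ge0_le0 ?powR_ge0// subr_le0 ltW.
apply: le_trans (_ : y `^ s * (1 + s / y) * (1 - s / y) <= _).
  by rewrite ler_wpM2r ?subr_ge0// powR_succ_le.
rewrite -mulrA ger_pMr ?powR_gt0//.
by have := sqr_ge0 (s / y); lra.
Qed.

Lemma powR_pred_le (R : realType) (s y : R) : 0 < s < 1 -> 1 < y ->
  (y - 1) `^ s * (1 + s / y) <= y `^ s.
Proof.
move=> s01 y1; have y0 : 0 < y by lra.
have -> : y - 1 = y * (1 - y^-1) by field; lra.
have yV : y^-1 < 1 by rewrite invf_lt1.
rewrite powRM; [|lra..].
rewrite -mulrA ger_pMr ?powR_gt0//.
have /(powR_le_tangent s01) : 0 <= 1 - y^-1 by lra.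
rewrite [1 + _ - 1]addrAC subrr add0r mulrN => le.
have s0 : 0 <= s / y by case/andP: s01 => *; rewrite divr_ge0 ?ltW.
apply: le_trans (_ : (1 - s / y) * (1 + s / y) <= _).
  by rewrite ler_wpM2r// addr_ge0.
by have := sqr_ge0 (s / y); lra.
Qed.

(** * Passing to the limit in second-order expansions *)

(** Each slope within distance l of j differs from g j by at most e l, and
1 + ... + l <= l ^ 2. The factor 1/2 of a Taylor bound is given up. *)
Lemma int_taylor (R : realType) (G g : int -> R) (e : R) :
  (forall j, G (j + 1) = G j + g j) ->
  (forall j, `|g j - g (j - 1)| <= e) ->
  forall j i, `|G (j + i) - G j - i%:~R * g j| <= e * i%:~R ^+ 2.
Proof.
move=> GS ge j.
have e0 : 0 <= e by apply: le_trans (ge 0).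
have up (l : nat) : `|g (j + l%:Z) - g j| <= e * l%:R.
  elim: l => [|l IH]; first by rewrite addr0 subrr normr0 mulr0.
  have := ge (j + l.+1%:Z); have -> : j + l.+1%:Z - 1 = j + l%:Z by lia.
  move: IH; rewrite -natr1 mulrDr mulr1 !ler_norml; lra.
have down (l : nat) : `|g (j - l%:Z) - g j| <= e * l%:R.
  elim: l => [|l IH]; first by rewrite subr0 subrr normr0 mulr0.
  have := ge (j - l%:Z); have -> : j - l%:Z - 1 = j - l.+1%:Z by lia.
  move: IH; rewrite -natr1 mulrDr mulr1 !ler_norml; lra.
have sq (l : nat) : e * l.+1%:R ^+ 2 = e * l%:R ^+ 2 + e * l%:R + e * l.+1%:R.
  by rewrite -natr1; ring.
move=> [] l; last first.
  rewrite NegzE mulrNz sqrrN -pmulrn; elim: (l.+1) => [|{}l IH].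
    by rewrite subr0 subrr oppr0 mul0r subr0 normr0 expr0n mulr0.
  have := GS (j - l.+1%:Z).
  have -> : j - l.+1%:Z + 1 = j - l%:Z by lia.
  move=> GE; move: IH (down l.+1); rewrite sq GE -natr1 !ler_norml.
  have : 0 <= e * l%:R by rewrite mulr_ge0.
  by lra.
rewrite -pmulrn; elim: l => [|l IH].
  by rewrite addr0 subrr mul0r subr0 normr0 expr0n mulr0.
have := GS (j + l%:Z).
have -> : j + l%:Z + 1 = j + l.+1%:Z by lia.
move=> GE; move: IH (up l); rewrite sq GE -natr1 !ler_norml.
have : 0 <= e * l.+1%:R by rewrite mulr_ge0.
by rewrite -natr1; lra.
Qed.

(** The slopes phi n x at a given x need not converge, but they stay in a
compact interval, and any of their cluster points can serve as f x: the
expansions hold for infinitely many n with a slope as close to f x as wanted,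
while the other terms converge. *)
Lemma limit_quadratic_approx (R : realType) (F : R -> R)
    (Fn phi : nat -> R -> R) (h : nat -> R) (C : R) :
  h @ \oo --> 0 -> (forall n x, 0 <= phi n x <= C) ->
  (forall n x t, `|Fn n (x + t) - Fn n x - t * phi n x|
     <= C * ((`|t| + h n) ^+ 2 + h n)) ->
  (forall x, Fn n x @[n --> \oo] --> F x) ->
  exists f : R -> R, (forall x, 0 <= f x <= C) /\
    forall x t, `|F (x + t) - F x - t * f x| <= C * t ^+ 2.
Proof.
move=> h0 phiC Fphi FnF.
have cl x : exists p, 0 <= p <= C /\ cluster (phi n x @[n --> \oo]) p.
  have [] := @segment_compact R 0 C (phi n x @[n --> \oo]) _ _.
    by exists 0%N => // n _ /=; rewrite in_itv/=.
  by move=> p [/=]; rewrite in_itv/=; exists p.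
have [f fP] := choice cl; exists f; split=> [x|x t]; first by case: (fP x).
apply/ler_addgt0Pr => e e0.
have [_ /(_ [set v | `|F (x + t) - F x - t * v| <= C * t ^+ 2 + e / 2]
  (ball (f x) (e / 2 / (`|t| + 1))))] := fP x.
have t1 : 0 < `|t| + 1 by rewrite ltr_wpDl.
case.
- have errcvg : C * ((`|t| + h n) ^+ 2 + h n) @[n --> \oo] -->
      C * ((`|t| + 0) ^+ 2 + 0).
    have hlim : `|t| + h n @[n --> \oo] --> `|t| + 0 by exact: cvgD (cvg_cst _) h0.
    by apply: cvgMr; apply: cvgD => //; exact: (cvgM hlim hlim).
  have Fcvg : Fn n (x + t) - Fn n x @[n --> \oo] --> F (x + t) - F x.
    exact: cvgB.
  have e4 : 0 < e / 4 by rewrite divr_gt0.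
  change (\forall n \near \oo,
    `|F (x + t) - F x - t * phi n x| <= C * t ^+ 2 + e / 2).
  near=> n; have := Fphi n x t.
  have : `|C * ((`|t| + 0) ^+ 2 + 0) - C * ((`|t| + h n) ^+ 2 + h n)| <= e / 4.
    by near: n; move/cvgrPdist_le : errcvg; exact.
  have : `|F (x + t) - F x - (Fn n (x + t) - Fn n x)| <= e / 4.
    by near: n; move/cvgrPdist_le : Fcvg; exact.
  by rewrite !addr0 real_normK ?num_real// !ler_norml; lra.
- exact: nbhsx_ballx (divr_gt0 (divr_gt0 e0 _) t1).
- move=> v [/= Fv]; rewrite /ball/= ltr_pdivlMr// => fv.
  apply: le_trans (_ : `|F (x + t) - F x - t * v| + `|t * (v - f x)| <= _).
    by apply: le_trans (ler_normD _ _); rewrite le_eqVlt; apply/orP; left;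
       apply/eqP; congr `|_|; ring.
  have : `|t * (v - f x)| <= e / 2.
    rewrite normrM distrC mulrC (le_trans _ (ltW fv))// ler_wpM2l//.
    by rewrite lerDl.
  by move: Fv; lra.
Unshelve. all: by end_near. Qed.

(** The increment of F between x and z, expanded from both ends. *)
Lemma quadratic_approx_lipschitz (R : realType) (F f : R -> R) (C : R) :
  (forall x t, `|F (x + t) - F x - t * f x| <= C * t ^+ 2) ->
  forall x z, `|f x - f z| <= 2 * C * `|x - z|.
Proof.
move=> Ff x z; have [->|xz] := eqVneq x z; first by rewrite !subrr normr0 mulr0.
have d0 : 0 < `|x - z| by rewrite normr_gt0 subr_eq0.
rewrite -(ler_pM2l d0) -normrM.
have := Ff x (z - x); have := Ff z (x - z).
rewrite !subrKC => h1 h2.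
have -> : `|x - z| * (2 * C * `|x - z|) = C * (x - z) ^+ 2 + C * (z - x) ^+ 2.
  by rewrite -(real_normK (num_real (x - z))) -(real_normK (num_real (z - x)))
     (distrC z x); ring.
apply: le_trans (lerD h1 h2); apply: le_trans (ler_normD _ _).
by rewrite le_eqVlt; apply/orP; left; apply/eqP; congr `|_|; ring.
Qed.

Lemma lipschitz_continuous (R : realType) (f : R -> R) (C : R) :
  (forall x z, `|f x - f z| <= C * `|x - z|) -> continuous f.
Proof.
move=> fC x; apply/cvgrPdist_le => e e0.
have C1 : 0 < `|C| + 1 by rewrite ltr_wpDl.
near=> z; apply: le_trans (fC x z) _.
have : `|x - z| <= e / (`|C| + 1).
  by near: z; apply: (@cvgr_dist_le _ _ _ _ _ id x) => //; rewrite divr_gt0.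
rewrite ler_pdivlMr// mulrC; apply: le_trans; rewrite ler_wpM2r//.
by rewrite (le_trans (ler_norm _))// lerDl.
Unshelve. all: by end_near. Qed.

Lemma quadratic_approx_derive (R : realType) (F f : R -> R) (C : R) :
  (forall x t, `|F (x + t) - F x - t * f x| <= C * t ^+ 2) ->
  forall x, is_derive x (1 : R) F (f x).
Proof.
move=> Ff x.
have lim : h^-1 *: ((F \o shift x) (h *: (1 : R)) - F x) @[h --> 0^'] --> f x.
  apply/cvgrPdist_le => e e0.
  have C1 : 0 < `|C| + 1 by rewrite ltr_wpDl.
  near=> h; have h0 : h != 0 by near: h; exact: nbhs_dnbhs_neq.
  have hn : 0 < `|h| by rewrite normr_gt0.
  have := Ff x h.
  have -> : F (x + h) - F x - h * f x =
      - (h * (f x - h^-1 *: (F (h + x) - F x))).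
    by rewrite /GRing.scale/= (addrC x); field.
  rewrite /= [h *: 1]mulr1 normrN normrM -(real_normK (num_real h)) expr2 mulrCA.
  rewrite ler_pM2l// => /le_trans; apply.
  have : `|h| <= e / (`|C| + 1).
    by near: h; apply: dnbhs0_le; rewrite divr_gt0.
  rewrite ler_pdivlMr// mulrC; apply: le_trans; rewrite ler_wpM2r//.
  by rewrite (le_trans (ler_norm _))// lerDl.
by apply: DeriveDef; [apply/cvg_ex; exists (f x) | exact: cvg_lim lim].
Unshelve. all: by end_near. Qed.

(** * Probability measures given by a continuous density *)

Section DensityMeasure.
Context (R : realType) (f : R -> R).
Context (f_meas : measurable_fun [set: R] f) (f_ge0 : forall x, 0 <= f x).
Local Open Scope ereal_scope.

(** The two proofs are arguments so that the measure structure below is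
inferred from the expression alone. *)
Definition density_measure of measurable_fun [set: R] f
    & (forall x, 0 <= f x)%R := fun A : set R =>
  \int[lebesgue_measure]_(x in A) (f x)%:E.

Local Notation nu := (density_measure f_meas f_ge0).

Let nu0 : nu set0 = 0. Proof. exact: integral_set0. Qed.

Let nu_ge0 A : 0 <= nu A.
Proof. by apply: integral_ge0 => x _; rewrite lee_fin. Qed.

Let nu_sigma_additive : semi_sigma_additive nu.
Proof.
move=> A mA tA mUA; rewrite [X in _ --> X]ge0_integral_bigcup//=.
- apply: is_cvg_ereal_nneg_natsum_cond => n _ _; exact: nu_ge0.
- by apply/measurable_EFinP; exact: measurable_funTS.
- by move=> x _; rewrite lee_fin.
Qed.

HB.instance Definition _ := isMeasure.Build _ _ _
  nu nu0 nu_ge0 nu_sigma_additive.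

(** Half-open intervals are stable under intersection and generate the Borel
sets. *)
Lemma is_density_of_itv (mu : probability R R) :
  (forall x z : R, (x < z)%R ->
     mu `]x, z]%classic = \int[lebesgue_measure]_(t in `[x, z]) (f t)%:E) ->
  is_density mu f.
Proof.
move=> muf; split => // A mA.
apply: (@measure_unique _ R R (@ocitv R)
  (fun k => `](- k%:R)%R, k%:R]%classic) _ _ _ _ mu nu).
- by [].
- exact: ocitvI.
- by move=> k; exact: is_ocitv.
- rewrite -subTset => x _; exists (Num.truncn `|x|).+1 => //=.
  have : (`|x| < (Num.truncn `|x|).+1%:R)%R by rewrite truncnS_gt.
  by rewrite in_itv/= ltr_norml => /andP[-> /ltW ->].
- move=> _ [[x z]] _ <- /=.
  have [xz|zx] := ltP x z; last first.
    by rewrite set_itv_ge ?measure0// bnd_simp -leNgt.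
  rewrite muf// /density_measure integral_itv_obnd_cbnd//.
  by apply/measurable_EFinP; exact: measurable_funTS.
- by move=> k; rewrite (le_lt_trans (probability_le1 _ _))// ltry.
- exact: mA.
Qed.

End DensityMeasure.

Lemma is_density_of_derive (R : realType) (mu : probability R R)
    (F f : R -> R) : (forall x, 0 <= f x) -> continuous f ->
  (forall x, is_derive x (1 : R) F (f x)) ->
  (forall x z : R, x < z -> mu `]x, z]%classic = (F z - F x)%:E) ->
  is_density mu f.
Proof.
move=> f0 fc Ff muF.
have fm : measurable_fun [set: R] f by exact: continuous_measurable_fun.
have Fc : continuous F.
  by move=> x; apply: differentiable_continuous; apply/derivable1_diffP.
apply: is_density_of_itv => // x z xz.
rewrite (continuous_FTC2 xz (F := F)) ?muF ?EFinB//.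
- by apply: continuous_subspaceT.
- split => [t _||]; first by case: (Ff t).
  + exact/cvg_at_right_filter/Fc.
  + exact/cvg_at_left_filter/Fc.
- by move=> t _; rewrite derive1E; case: (Ff t).
Qed.

(** * Almost sure limits, and marginals of a Markov process *)

(** If the limit is in the open set V, then X n is in V from some rank on. Hence
the events that X n is in V for all n >= k increase with k to an event that
contains almost all of the event that Y is in V. *)
Lemma open_portmanteau d (T : measurableType d) (R : realType)
    (P : probability T R) (X : nat -> T -> R) (Y : T -> R) (V : set R) (e : R) :
  (forall n, measurable_fun [set: T] (X n)) -> measurable_fun [set: T] Y ->
  {ae P, forall w, X n w @[n --> \oo] --> Y w} ->
  open V -> 0 < e ->
  \forall n \near \oo, fine (P (Y @^-1` V)) - e <= fine (P (X n @^-1` V)).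
Proof.
move=> mX mY [N [mN N0 XYN]] oV e0.
have mV : measurable V by exact: open_measurable.
have mXV n : measurable (X n @^-1` V) by rewrite -[_ @^-1` _]setTI; exact: mX.
have mYV : measurable (Y @^-1` V) by rewrite -[_ @^-1` _]setTI; exact: mY.
pose E k := \bigcap_(n in [set n | (k <= n)%N]) (X n @^-1` V).
have mE k : measurable (E k) by apply: bigcap_measurable => //; exists k => /=.
have mUE : measurable (\bigcup_k E k) by exact: bigcup_measurable.
have ndE : nondecreasing_seq E.
  move=> i j ij; apply/subsetPset => w Ew n /= jn; apply: Ew => /=.
  exact: leq_trans jn.
have cvgE := nondecreasing_cvg_mu mE mUE ndE.
have YE : (P (Y @^-1` V) <= P (\bigcup_k E k))%E.
  rewrite -[leRHS]adde0 -N0.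
  apply: le_trans (measureU2 _ _ _) => //.
  apply: le_measure; rewrite ?inE//; first exact: measurableU.
  move=> w Yw; have [XY|nXY] := pselect (X n w @[n --> \oo] --> Y w).
    left; have [k _ Ek] : \forall n \near \oo, V (X n w).
      by apply: XY; exact: open_nbhs_nbhs.
    by exists k => // n /= kn; exact: Ek.
  by right; apply: XYN.
have /fine_cvg/cvgrPdist_le/(_ _ e0) : (P \o E) n @[n --> \oo] -->
    (fine (P (\bigcup_k E k)))%:E by rewrite fineK ?fin_num_measure//; exact: cvgE.
apply: filterS => n /=; rewrite ler_norml => /andP[_].
have : fine (P (Y @^-1` V)) <= fine (P (\bigcup_k E k)).
  by rewrite fine_le ?fin_num_measure.
have : fine (P (E n)) <= fine (P (X n @^-1` V)).
  rewrite fine_le ?fin_num_measure// le_measure ?inE//.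
  by apply: bigcap_inf => /=.
by lra.
Qed.

Lemma pickle_fiber (u : nat * nat) : [set v | pickle v = pickle u] = [set u].
Proof. by apply/seteqP; split=> [v /= /(pcan_inj (@pickleK _))->|v ->]. Qed.

Lemma measurable_natpair (A : set (nat * nat)) : measurable A.
Proof.
have -> : A = \bigcup_(i in [set i | exists2 u, A u & pickle u = i])
    [set u | pickle u = i].
  apply/seteqP; split=> [u Au|u [i [v Av <-]] /= /(pcan_inj (@pickleK _))->//].
  by exists (pickle u) => //; exists u.
apply: bigcup_measurable => _ [[x z] _ <-]; rewrite pickle_fiber.
rewrite -(_ : [set x] `*` [set z] = [set (x, z)]); first exact: measurableX.
by apply/seteqP; split => -[? ?] []/= -> ->.
Qed.

Section Markov.
Context d (T : measurableType d) (R : realType) (P : probability T R).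
Local Open Scope ereal_scope.

Lemma measurable_fiber (X : {RV P >-> (nat * nat)%type}) u :
  measurable (X @^-1` [set u]).
Proof. by apply: measurable_funPTI; exact: measurable_natpair. Qed.

Lemma measure_fibers (X : {RV P >-> (nat * nat)%type}) (A : set T) :
  measurable A ->
  P A = \sum_(i <oo) P (A `&` X @^-1` [set u | pickle u = i]).
Proof.
move=> mA; rewrite (@eq_eseriesl _ xpredT (mem [set: nat])); last first.
  by move=> i; exact/esym/mem_setT.
rewrite -measure_bigcup//=.
- rewrite -setI_bigcupr -preimage_bigcup; congr (P _).
  rewrite [X in _ `&` X](_ : _ = setT) ?setIT//.
  by rewrite -subTset => w _; exists (pickle (X w)).
- move=> i _; apply: measurableI => //.
  by apply: measurable_funPTI; exact: measurable_natpair.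
- by move=> i j _ _ [w [[_ <-] [_ <-]]].
Qed.

(** A variable of a history is summed out: if the measures of two events are
in the same ratio above each of its values, they are in this ratio. *)
Lemma measure_fibers_scale (X : {RV P >-> (nat * nat)%type}) (A B : set T)
    (t : R) : measurable A -> measurable B ->
  (forall u, P (B `&` X @^-1` [set u]) = P (A `&` X @^-1` [set u]) * t%:E) ->
  P B = P A * t%:E.
Proof.
move=> mA mB BA; rewrite (measure_fibers X mB) (measure_fibers X mA).
rewrite muleC -nneseriesZl//; apply: eq_eseriesr => i _; rewrite muleC.
have [[u <-]|no] := pselect (exists u : nat * nat, pickle u = i).
  by rewrite pickle_fiber; exact: BA.
rewrite (_ : [set _ | _] = set0) ?preimage_set0 ?setI0 ?measure0 ?mul0e//.
by apply/seteqP; split => // u ui; apply: no; exists u.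
Qed.

(** The event H k j h prescribes the coordinates k, ..., j - 1 of the history.
For k = 0 the product formula is the definition of the process; the
coordinates 0, ..., n - 1 are then summed out one after the other, the factor
depending only on the last two coordinates. *)
Lemma urn_process_transition (a b c d' al be : nat)
    (U : nat -> {RV P >-> (nat * nat)%type}) :
  is_urn_process a b c d' al be U -> forall n u v,
  P (U n @^-1` [set u] `&` U n.+1 @^-1` [set v]) =
  P (U n @^-1` [set u]) * (urn_trans R a b c d' u v)%:E.
Proof.
move=> [_ UP] n u v.
pose H k j (h : nat -> nat * nat) :=
  \bigcap_(i in [set i | (k <= i < j)%N]) (U i @^-1` [set h i]).
have mH k j h : measurable (H k j h).
  apply: bigcap_measurableType => i _; exact: measurable_fiber.
have marg k : (k <= n)%N -> forall h,
    P (H k n.+2 h) = P (H k n.+1 h) * (urn_trans R a b c d' (h n) (h n.+1))%:E.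
  elim: k => [_ h|k IH kn h]; first exact: UP.
  apply: (measure_fibers_scale (X := U k)) => // w.
  pose h' i := if i == k then w else h i.
  have HE j : (k < j)%N -> H k.+1 j h `&` U k @^-1` [set w] = H k j h'.
    move=> kj; apply/seteqP; split => [z [Hz Uz] i /= /andP[]|z Hz].
      rewrite leq_eqVlt /h' => /predU1P[<- _|ki ij]; first by rewrite eqxx.
      by rewrite gtn_eqF//; apply: Hz => /=; rewrite ki.
    split=> [i /= /andP[ki ij]|].
      by have := Hz i; rewrite /= /h' gtn_eqF//; apply; rewrite ltnW.
    by have := Hz k; rewrite /= /h' eqxx; apply; rewrite leqnn.
  rewrite !HE; [|lia..]; rewrite (IH (ltnW kn) h').
  by rewrite /h' !gtn_eqF; [|lia..].
pose h i := if i == n then u else v.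
have -> : U n @^-1` [set u] `&` U n.+1 @^-1` [set v] = H n n.+2 h.
  apply/seteqP; split => [z [Uu Uv] i /= /andP[ni ij]|z Hz].
    have : (i == n) || (i == n.+1) by lia.
    by rewrite /h => /orP[] /eqP->; rewrite ?eqxx// gtn_eqF// ltnSn.
  split; [have := Hz n|have := Hz n.+1]; rewrite /= /h ?eqxx ?gtn_eqF//;
  by apply; rewrite ?leqnn ?leqnSn ?ltnSn.
have -> : U n @^-1` [set u] = H n n.+1 h.
  apply/seteqP; split => [z Uu i /= /andP[ni ij]|z Hz].
    have -> : i = n by lia.
    by rewrite /h eqxx.
  by have := Hz n; rewrite /= /h eqxx; apply; rewrite leqnn ltnSn.
by rewrite marg// /h eqxx gtn_eqF.
Qed.

End Markov.

(** As the p i add up to 1, the fibres above the x i cover the space up to a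
null set. *)
Lemma measure_finite_support d (T : measurableType d) (R : realType)
    (P : probability T R) (X : {RV P >-> (nat * nat)%type}) (N : nat)
    (x : 'I_N -> nat * nat) (p : 'I_N -> R) : injective x ->
  (forall i, P (X @^-1` [set x i]) = (p i)%:E) -> \sum_(i < N) p i = 1 ->
  forall B, measurable B ->
    P B = (\sum_(i < N) P (B `&` X @^-1` [set x i]))%E.
Proof.
move=> xI Xp p1 B mB.
have mX i : measurable (X @^-1` [set x i]) by exact: measurable_fiber.
pose D := \big[setU/set0]_(i < N) (X @^-1` [set x i]).
have sum A : measurable A ->
    (\sum_(i < N) P (A `&` X @^-1` [set x i]))%E = P (A `&` D).
  move=> mA; rewrite /D big_distrr/= (@measure_bigsetU_ord _ _ _ _ _ xpredT)//.
    by move=> i; exact: measurableI.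
  by move=> i j _ _ [w [[_ Xi] [_ Xj]]]; apply: xI; rewrite -Xi -Xj.
have mD : measurable D by exact: bigsetU_measurable.
have D1 : P D = 1%E.
  rewrite -[D]setTI -sum//; under eq_bigr do rewrite setTI Xp.
  by rewrite sumEFin p1.
rewrite sum// (measureDI P mB mD) [X in (X + _)%E](_ : _ = 0%E) ?add0e//.
apply/eqP; rewrite eq_le measure_ge0 andbT.
have <- : P (~` D) = 0%E by rewrite probability_setC// D1 subee.
by rewrite le_measure ?inE//; [exact: measurableD|exact: measurableC].
Qed.

Lemma card_ord_lt (N M : nat) : (M <= N)%N ->
  #|[set k : 'I_N | (k < M)%N]%SET| = M.
Proof.
move=> MN; rewrite cardsE -sum1_card.
transitivity (\sum_(i < N | (i < M)%N) 1)%N; first exact: eq_bigl.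
by rewrite -(big_ord_widen N (fun=> 1%N))// sum1_card card_ord.
Qed.

Lemma urn_sigmaE (R : realType) (b c m : nat) :
  urn_sigma R (c + m) b c = m%:R / (b + c + m)%:R.
Proof.
rewrite /urn_sigma natrD addrAC subrr add0r -addnA [(m + b)%N]addnC addnA.
by rewrite [(c + b)%N]addnC.
Qed.

Lemma sum_subset_le (R : realType) (I : finType) (A B : pred I) (F : I -> R) :
  (forall i, A i -> B i) -> (forall i, 0 <= F i) ->
  \sum_(i | A i) F i <= \sum_(i | B i) F i.
Proof.
move=> AB F0; rewrite big_mkcond [leRHS]big_mkcond/=; apply: ler_sum => i _.
by case: ifPn => [/AB->//|_]; case: ifP.
Qed.

(** * The Markov chain of the number of red draws *)

Section BalancedUrn.
Context (R : realType) (al be b c m : nat).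
Context (b_gt0 : (0 < b)%N) (c_gt0 : (0 < c)%N) (m_gt0 : (0 < m)%N).
Context (init_gt0 : (0 < al + be)%N).

(** The number of balls after n draws, divided by the number of balls added at
each draw ([urn_sizeE]). Powers of this quantity replace powers of n because
one more draw increases it by exactly 1. *)
Definition urn_time (n : nat) : R := n%:R + (al + be)%:R / (b + c + m)%:R.

(** The affine function of k is taken on all integers, although it is a
probability only on the possible numbers of red draws: the differences of the
law reach slightly beyond them, and the cancellations there need the affine
form. *)
Definition red_prob (n : nat) (k : int) : R :=
  (al%:R + c%:R * n%:R + m%:R * k%:~R) / ((b + c + m)%:R * urn_time n).

Definition red_step (n : nat) (f : int -> R) (k : int) : R :=
  (1 - red_prob n k) * f k + red_prob n (k - 1) * f (k - 1).

(** The law after j draws of a chain that has the law f at time n. *)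
Fixpoint red_law (n : nat) (f : int -> R) (j : nat) : int -> R :=
  if j is j'.+1 then red_step (n + j') (red_law n f j') else f.

Definition red_supp (n : nat) (f : int -> R) : Prop :=
  forall k : int, ~~ (0 <= k <= n%:Z) -> f k = 0.

Local Notation S := ((b + c + m)%:R : R).
Local Notation y := urn_time.
Local Notation s := (m%:R / S).
Local Notation q := red_prob.
Local Notation w n := (y n `^ s).

Lemma urn_size_gt0 : 0 < S. Proof. by rewrite ltr0n addn_gt0 m_gt0 orbT. Qed.

Lemma urn_time_gt0 n : 0 < y n.
Proof. by rewrite ltr_wpDl// divr_gt0// ?ltr0n//; lia. Qed.

Lemma urn_timeS n : y n.+1 = y n + 1.
Proof. by rewrite /urn_time -natr1 addrAC. Qed.

Lemma urn_time_ge n : n%:R <= y n.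
Proof. by rewrite lerDl divr_ge0. Qed.

Lemma urn_sizeE n : S * y n = ((b + c + m) * n + al + be)%:R.
Proof.
rewrite -(addnA (_ * _)%N) [RHS]natrD natrM mulrDr; congr (_ + _).
by rewrite mulrC divfK// gt_eqF// urn_size_gt0.
Qed.

Lemma sigma_itv : 0 < s < 1.
Proof.
rewrite divr_gt0 ?urn_size_gt0 ?ltr0n// ltr_pdivrMr ?urn_size_gt0// mul1r.
by rewrite ltr_nat -[X in (X < _)%N]add0n ltn_add2r addn_gt0 b_gt0.
Qed.

Lemma red_prob_pred n k : q n (k - 1) = q n k - s / y n.
Proof.
have S0 := urn_size_gt0; have y0 := urn_time_gt0 n.
rewrite /red_prob rmorphB/=; field.
by rewrite -!natrD !gt_eqF.
Qed.

Lemma red_prob_ge0 n (k : int) : - n%:Z <= m%:Z * k -> 0 <= q n k.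
Proof.
move=> h; apply: divr_ge0; last by rewrite mulr_ge0// ltW// urn_time_gt0.
have -> : al%:R + c%:R * n%:R + m%:R * k%:~R =
  (al%:Z + c%:Z * n%:Z + m%:Z * k)%:~R :> R by rewrite !(rmorphD, rmorphM).
rewrite ler0z; nia.
Qed.

Lemma red_probC n (k : int) : 1 - q n k =
  (be%:Z + (b + m)%:Z * n%:Z - m%:Z * k)%:~R / (S * y n).
Proof.
have S0 := urn_size_gt0; have y0 := urn_time_gt0 n.
have SE := urn_sizeE n.
apply: (@mulIf _ (S * y n)); first by rewrite mulf_neq0 ?gt_eqF.
rewrite mulrBl mul1r !divfK ?mulf_neq0 ?gt_eqF//.
by rewrite SE !(rmorphB, rmorphD, rmorphM, natrD, natrM)/=; ring.
Qed.

Lemma red_prob_le1 n (k : int) : m%:Z * (k - n%:Z) <= n%:Z -> q n k <= 1.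
Proof.
move=> h; rewrite -subr_ge0 red_probC.
apply: divr_ge0; last by rewrite mulr_ge0// ltW// urn_time_gt0.
rewrite ler0z; nia.
Qed.

Lemma red_prob_itv n (k : nat) : (k <= n)%N -> 0 <= q n k%:Z <= 1.
Proof. by move=> kn; rewrite red_prob_ge0 ?red_prob_le1//; nia. Qed.

Lemma red_supp_step n f : red_supp n f -> red_supp n.+1 (red_step n f).
Proof.
move=> sf k kn; rewrite /red_step !sf ?mulr0 ?addr0//; lia.
Qed.

Lemma red_step_ge0 n f : red_supp n f -> (forall k, 0 <= f k) ->
  forall k, 0 <= red_step n f k.
Proof.
move=> sf f0 k; rewrite /red_step addr_ge0//.
  have [kn|/sf->] := boolP (0 <= k <= n%:Z); last by rewrite mulr0.
  by rewrite mulr_ge0// subr_ge0 red_prob_le1//; nia.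
have [kn|/sf->] := boolP (0 <= k - 1 <= n%:Z); last by rewrite mulr0.
by rewrite mulr_ge0// red_prob_ge0//; nia.
Qed.

Lemma red_supp_law n f : red_supp n f ->
  forall j, red_supp (n + j) (red_law n f j).
Proof.
move=> sf; elim=> [|j IH]; first by rewrite addn0.
by rewrite addnS; exact: red_supp_step.
Qed.

Lemma red_law_ge0 n f : red_supp n f -> (forall k, 0 <= f k) ->
  forall j k, 0 <= red_law n f j k.
Proof.
move=> sf f0; elim=> //= j IH k.
by apply: red_step_ge0 => //; exact: red_supp_law.
Qed.

(** Summation by parts: the mean of g after a draw is the mean of the
conditional mean of g. *)
Lemma red_step_sum n f (g : int -> R) : red_supp n f ->
  \sum_(i < n.+2) red_step n f i%:Z * g i%:Z =
  \sum_(i < n.+1) f i%:Z *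
     ((1 - q n i%:Z) * g i%:Z + q n i%:Z * g (i%:Z + 1)).
Proof.
move=> sf; under eq_bigr do rewrite /red_step mulrDl.
rewrite big_split/= big_ord_recr/= [X in _ + X]big_ord_recl/=.
rewrite (sf n.+1) ?(sf (0 - 1)); [|lia..].
rewrite !(mulr0, mul0r) addr0 add0r -big_split/=; apply: eq_bigr => i _.
have -> : (bump 0 i)%:Z - 1 = i%:Z by rewrite /bump; lia.
have -> : (bump 0 i)%:Z = i%:Z + 1 by rewrite /bump; lia.
by ring.
Qed.

Lemma red_law_mass n f : red_supp n f -> forall j,
  \sum_(i < (n + j).+1) red_law n f j i%:Z = \sum_(i < n.+1) f i%:Z.
Proof.
move=> sf; elim=> [|j IH]; first by rewrite addn0.
rewrite addnS -IH -[LHS](eq_bigr _ (fun i _ => mulr1 _)).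
rewrite (red_step_sum (fun=> 1)); last exact: red_supp_law.
by apply: eq_bigr => i _; rewrite !mulr1 subrK mulr1.
Qed.

Definition red_dist (n : nat) : int -> R :=
  red_law 0 (fun k : int => (k == 0)%:R) n.

Lemma red_dist_supp n : red_supp n (red_dist n).
Proof.
by apply: (@red_supp_law 0 _ _ n) => k; case: eqP => // ->; rewrite lexx.
Qed.

Lemma red_dist_ge0 n k : 0 <= red_dist n k.
Proof.
by apply: red_law_ge0 => [{}k|//]; case: eqP => // ->; rewrite lexx.
Qed.

Lemma red_dist_mass n : \sum_(i < n.+1) red_dist n i%:Z = 1.
Proof.
rewrite (@red_law_mass 0 _ _ n) ?big_ord1//.
by move=> k; case: eqP => // ->; rewrite lexx.
Qed.

Lemma red_dist_le1 n k : red_dist n k <= 1.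
Proof.
have [kn|/red_dist_supp->//] := boolP (0 <= k <= n%:Z).
case: k kn => // k kn; have kn1 : (k < n.+1)%N by lia.
rewrite -(red_dist_mass n) (bigD1 (Ordinal kn1))//= lerDl.
by apply: sumr_ge0 => i _; exact: red_dist_ge0.
Qed.

(** * Decay of the law of the number of red draws *)

Lemma urn_weight_gt0 n : 0 < w n.
Proof. by rewrite powR_gt0// urn_time_gt0. Qed.

Lemma urn_time_homo i j : (i <= j)%N -> y i <= y j.
Proof. by move=> ij; rewrite lerD2r ler_nat. Qed.

Lemma urn_weight_homo i j : (i <= j)%N -> w i <= w j.
Proof.
move=> ij; have /andP[/ltW s0 _] := sigma_itv.
by apply: ge0_ler_powR => //; rewrite ?nnegrE ?urn_time_homo// ltW// urn_time_gt0.
Qed.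

(** From time 2 m on, the affine function is a probability up to two units beyond
the possible numbers of red draws, because b and c are at least 1. This is as
far as the recursions for the law and its differences reach. *)
Lemma red_prob_late n (k : int) : (2 * m <= n)%N -> - 2 <= k <= n%:Z + 2 ->
  0 <= q n k <= 1.
Proof.
by move=> mn kn; rewrite red_prob_ge0 ?red_prob_le1//; nia.
Qed.

Lemma urn_rate_late n : (2 * m <= n)%N -> 0 <= 1 - s / y n.
Proof.
move=> mn; have y0 := urn_time_gt0 n; have /andP[s0 s1] := sigma_itv.
rewrite subr_ge0 ler_pdivrMr// mul1r (le_trans (ltW s1))//.
by rewrite (le_trans _ (urn_time_ge n))// ler1n; lia.
Qed.

Lemma urn_weight_step n : (1 - s / y n) / w n <= (w n.+1)^-1.
Proof.
rewrite ler_pdivrMr ?urn_weight_gt0// ler_pdivlMl ?urn_weight_gt0//.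
by rewrite urn_timeS powR_succ_ge ?sigma_itv ?urn_time_gt0.
Qed.

(** The coefficients of the recursion are nonnegative from time 2 m on and add up
to 1 - s / y n; up to time 2 m, the bound is at least 1. *)
Lemma red_dist_bound n k : red_dist n k <= w (2 * m) / w n.
Proof.
have [nm|/ltnW] := leqP n (2 * m).
  apply: le_trans (red_dist_le1 _ _) _.
  by rewrite ler_pdivlMr ?urn_weight_gt0// mul1r urn_weight_homo.
elim: n => [|n IH] in k *; first lia.
rewrite leq_eqVlt => /predU1P[<-|mn].
  by rewrite divff ?red_dist_le1// gt_eqF ?urn_weight_gt0.
have [kn|/red_dist_supp->] := boolP (0 <= k <= n.+1%:Z); last first.
  by rewrite divr_ge0 ?powR_ge0.
rewrite [leLHS]/red_dist/= /red_step add0n.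
have /andP[_ q1] : 0 <= q n k <= 1 by apply: red_prob_late; lia.
have /andP[q0 _] : 0 <= q n (k - 1) <= 1 by apply: red_prob_late; lia.
apply: le_trans (_ : (1 - q n k + q n (k - 1)) * (w (2 * m) / w n) <= _).
  by rewrite [leRHS]mulrDl lerD// ler_wpM2l ?subr_ge0//; apply: IH; lia.
rewrite red_prob_pred addrA subrK mulrCA ler_wpM2l ?powR_ge0//.
exact: urn_weight_step.
Qed.

Definition red_diff n (k : int) : R := red_dist n k - red_dist n (k - 1).

(** In the difference of two steps of the law, what is left besides the
differences of p_n is p_n(k-1) times 2 q(k-1) - q(k) - q(k-2), which vanishes
because q is affine. *)
Lemma red_diffS n k : red_diff n.+1 k =
  (1 - q n k) * red_diff n k + q n (k - 2) * red_diff n (k - 1).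
Proof.
rewrite /red_diff /red_dist/= /red_step add0n -/(red_dist n).
have -> : k - 2 = k - 1 - 1 by lia.
by rewrite !red_prob_pred; ring.
Qed.

(** Same argument as for the law itself; the coefficients now add up to
1 - 2 s / y n, which is at most the square of 1 - s / y n. *)
Lemma red_diff_bound n k : `|red_diff n k| <= (w (2 * m) / w n) ^+ 2.
Proof.
have le1 i l : `|red_diff i l| <= 1.
  have := red_dist_le1 i l; have := red_dist_le1 i (l - 1).
  have := red_dist_ge0 i l; have := red_dist_ge0 i (l - 1).
  by rewrite /red_diff ler_norml; lra.
have [nm|/ltnW] := leqP n (2 * m).
  apply: le_trans (le1 _ _) _; rewrite exprn_ege1//.
  by rewrite ler_pdivlMr ?urn_weight_gt0// mul1r urn_weight_homo.
elim: n => [|n IH] in k *; first lia.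
rewrite leq_eqVlt => /predU1P[<-|mn].
  by rewrite divff ?expr1n// gt_eqF ?urn_weight_gt0.
have [kn|kn] := boolP (0 <= k <= n.+2%:Z); last first.
  by rewrite /red_diff !red_dist_supp ?subr0 ?normr0 ?sqr_ge0//; lia.
rewrite red_diffS.
have /andP[_ q1] : 0 <= q n k <= 1 by apply: red_prob_late; lia.
have /andP[q0 _] : 0 <= q n (k - 2) <= 1 by apply: red_prob_late; lia.
apply: le_trans (_ : (1 - q n k + q n (k - 2)) * (w (2 * m) / w n) ^+ 2 <= _).
  rewrite [leRHS]mulrDl (le_trans (ler_normD _ _))// 2!normrM.
  rewrite (ger0_norm q0) (@ger0_norm _ (1 - _)) ?subr_ge0//.
  by rewrite lerD// ler_wpM2l ?subr_ge0//; apply: IH; lia.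
have -> : 1 - q n k + q n (k - 2) = (1 - s / y n) ^+ 2 - (s / y n) ^+ 2.
  have -> : k - 2 = k - 1 - 1 by lia.
  by rewrite !red_prob_pred; ring.
apply: le_trans (_ : (1 - s / y n) ^+ 2 * (w (2 * m) / w n) ^+ 2 <= _).
  by rewrite ler_wpM2r ?sqr_ge0// gerBl sqr_ge0.
have u0 := urn_rate_late mn; have C0 i j : 0 <= w i / w j by rewrite divr_ge0 ?powR_ge0.
rewrite -exprMn ler_pXn2r ?nnegrE// ?(mulr_ge0 u0)//.
by rewrite mulrCA ler_wpM2l ?powR_ge0// urn_weight_step.
Qed.

Local Notation p := red_dist.

(** * The law of the composition of the urn *)

(** Composition after n draws among which k are red. *)
Definition red_comp (n k : nat) : nat * nat :=
  (al + c * n + m * k, be + b * n + m * (n - k))%N.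

Lemma red_comp_inj n i j : red_comp n i = red_comp n j -> i = j.
Proof. by rewrite /red_comp => -[/eqP + _]; rewrite eqn_add2l eqn_pmul2l// => /eqP. Qed.

Local Notation tr := (urn_trans R (c + m) b c (b + m)).

Lemma red_comp_size n k : (k <= n)%N ->
  ((red_comp n k).1 + (red_comp n k).2 = (b + c + m) * n + al + be)%N.
Proof. by move=> kn; rewrite /red_comp/=; nia. Qed.

Lemma urn_trans_red n k : (k <= n)%N ->
  tr (red_comp n k) (red_comp n.+1 k.+1) = q n k%:Z.
Proof.
move=> kn; rewrite /urn_trans /red_prob urn_sizeE// -(red_comp_size kn).
congr (_ / _); rewrite (_ : [set _ | _]%SET = [set j : 'I__ | (j < (red_comp n k).1)%N]%SET).
  by rewrite card_ord_lt ?leq_addr//= -!natrM -!natrD.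
apply/setP => j; rewrite !inE /urn_step; case: ifP => _.
  by apply/eqP; rewrite /red_comp/=; congr (_, _); nia.
by apply/eqP => -[]; nia.
Qed.

Lemma urn_trans_black n k : (k <= n)%N ->
  tr (red_comp n k) (red_comp n.+1 k) = 1 - q n k%:Z.
Proof.
move=> kn; rewrite /urn_trans red_probC//.
rewrite urn_sizeE// -(red_comp_size kn); congr (_ / _).
rewrite (_ : [set _ | _]%SET = ~: [set j : 'I__ | (j < (red_comp n k).1)%N]%SET).
  have := cardsC [set j : 'I__ | (j < (red_comp n k).1)%N]%SET.
  move/(_ ((red_comp n k).1 + (red_comp n k).2)%N).
  rewrite card_ord_lt ?leq_addr// card_ord => /addnI->.
  by rewrite pmulrn; congr (_%:~R); rewrite /red_comp/=; nia.
apply/setP => j; rewrite !inE /urn_step; case: ifP => _.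
  by apply/eqP => -[]; nia.
by apply/eqP; rewrite /red_comp/=; congr (_, _); nia.
Qed.

Lemma urn_trans_other n k l : (k <= n)%N -> l != k -> l != k.+1 ->
  tr (red_comp n k) (red_comp n.+1 l) = 0.
Proof.
move=> kn lk lk1; rewrite /urn_trans (_ : [set _ | _]%SET = finset.set0) ?cards0 ?mul0r//.
apply/setP => j; rewrite !inE /urn_step; case: ifP => _; apply/eqP => -[].
  by move: lk lk1; nia.
by move: lk lk1; nia.
Qed.

Lemma urn_process_law d0 (T : measurableType d0) (P : probability T R)
    (U : nat -> {RV P >-> (nat * nat)%type}) :
  is_urn_process (c + m) b c (b + m) al be U ->
  forall n k, (k <= n)%N ->
    P (U n @^-1` [set red_comp n k]) = (red_dist n k%:Z)%:E.
Proof.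
move=> UP; elim=> [|n IH] l ln.
  move: ln; rewrite leqn0 => /eqP->; rewrite /red_comp !muln0 !addn0.
  by case: UP => ->.
rewrite (@measure_finite_support _ _ _ P (U n) n.+1 (red_comp n)
   (fun k => red_dist n k%:Z)); last first.
- exact: measurable_fiber.
- exact: red_dist_mass.
- by move=> i; apply: IH; rewrite -ltnS.
- by move=> i j /red_comp_inj; exact: val_inj.
transitivity (\sum_(k < n.+1) (red_dist n k%:Z *
    ((1 - q n k%:Z) * (k%:Z == l%:Z)%:R + q n k%:Z * (k%:Z + 1 == l%:Z)%:R))%:E)%E.
  apply: eq_bigr => k _; have kn : (k <= n)%N by rewrite -ltnS.
  rewrite setIC (urn_process_transition UP) IH// -EFinM; congr (_ * _)%:E.
  have -> : (k%:Z + 1 == l%:Z) = (k.+1 == l) by lia.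
  have -> : (k%:Z == l%:Z) = (nat_of_ord k == l) by lia.
  have [<-|kl] := eqVneq (nat_of_ord k) l.
    by rewrite urn_trans_black// gtn_eqF// mulr1 mulr0 addr0.
  have [<-|kl1] := eqVneq k.+1 l.
    by rewrite urn_trans_red// mulr1 mulr0 add0r.
  by rewrite urn_trans_other// 1?eq_sym// !mulr0 addr0.
rewrite sumEFin; congr (_%:E).
rewrite -(red_step_sum (fun i => (i == l%:Z)%:R)); last first.
  exact: red_dist_supp.
rewrite (bigD1 (Ordinal (ln : (l < n.+2)%N)))//= eqxx mulr1 big1 ?addr0//.
move=> i il; rewrite (_ : _ == _ = false) ?mulr0//.
by apply: contraNF il => /eqP[il]; apply/eqP/val_inj.
Qed.

(** * The rescaled urn and its distribution function *)

(** Value of u2 after n draws among which k are red, extended affinely to all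
integers k. *)
Definition red_u2 (n : nat) (k : int) : R :=
  S^-1 * (b%:R * al%:R - c%:R * be%:R - c%:R * m%:R * n%:R
          + (b + c)%:R * m%:R * k%:~R).

Lemma urn_u2_comp n k : (k <= n)%N ->
  urn_u2 R (c + m) b c (red_comp n k) = red_u2 n k%:Z.
Proof.
move=> kn; rewrite /urn_u2 /red_u2 /red_comp/= -(addnA b) (addnC b); congr (_ * _).
by rewrite !natrD !natrM natrB// -pmulrn; ring.
Qed.

Definition lattice_step (n : nat) : R := (b + c)%:R * m%:R / S / w n.

Lemma lattice_step_gt0 n : 0 < lattice_step n.
Proof.
have S0 : 0 < S by exact: urn_size_gt0.
have w0 : 0 < w n by exact: urn_weight_gt0.
by rewrite divr_gt0// divr_gt0// mulr_gt0 ?ltr0n//; lia.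
Qed.

Definition scaled_cdf (n : nat) (x : R) : R :=
  \sum_(k < n.+1 | red_u2 n k%:Z / w n < x) p n k%:Z.

(** Index of the first point of the lattice that is not below x. *)
Definition lattice_index (n : nat) (x : R) : int :=
  Num.ceil ((x - red_u2 n 0 / w n) / lattice_step n).

Lemma red_u2_lt n (k : int) x :
  (red_u2 n k / w n < x) = (k < lattice_index n x).
Proof.
rewrite /lattice_index ceil_gt_int ltr_pdivlMr ?lattice_step_gt0//.
rewrite ltrBrDl; congr (_ < _).
by rewrite /red_u2 /lattice_step mulr0 addr0; ring.
Qed.

(** On the lattice, [int_taylor] applies to the partial sums of the law with
slope p n k, and its error term e i ^ 2 with e of order h_n ^ 2 is of the order
of the square of the distance i h_n. Replacing the lattice points by x and
x + t costs one step at each end, that is an error of order h_n. *)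
Lemma scaled_cdf_expand : exists2 C : R, 0 <= C &
  exists2 phi : nat -> R -> R, (forall n x, 0 <= phi n x <= C) &
  forall n x t, `|scaled_cdf n (x + t) - scaled_cdf n x - t * phi n x|
    <= C * ((`|t| + lattice_step n) ^+ 2 + lattice_step n).
Proof.
pose e := (b + c)%:R * m%:R / S : R.
have e0 : 0 < e.
  have S0 : 0 < S by exact: urn_size_gt0.
  by rewrite divr_gt0// mulr_gt0 ?ltr0n//; lia.
pose K := w (2 * m) / e.
have K0 : 0 <= K by rewrite divr_ge0 ?powR_ge0// ltW.
have pK n k : p n k <= K * lattice_step n.
  apply: le_trans (red_dist_bound _ _) _ => //.
  rewrite /K /lattice_step -/e mulrA divfK// gt_eqF//.
have dK n k : `|red_diff n k| <= (K * lattice_step n) ^+ 2.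
  apply: le_trans (red_diff_bound _ _) _ => //.
  by rewrite /K /lattice_step -/e mulrA divfK// gt_eqF.
exists (K + K ^+ 2); first by rewrite addr_ge0 ?sqr_ge0.
exists (fun n x => p n (lattice_index n x) / lattice_step n) => [n x|n x t].
  have h0 := lattice_step_gt0 n.
  rewrite divr_ge0 ?red_dist_ge0 ?(ltW h0)//= ler_pdivrMr//.
  by rewrite (le_trans (pK _ _))// ler_wpM2r ?(ltW h0)// lerDl sqr_ge0.
pose Phi n (j : int) : R := \sum_(k < n.+1 | k%:Z < j) p n k%:Z.
have cdfE z : scaled_cdf n z = Phi n (lattice_index n z).
  by apply: eq_bigl => k; rewrite red_u2_lt.
have PhiS j : Phi n (j + 1) = Phi n j + p n j.
  rewrite /Phi (bigID (fun k : 'I_n.+1 => k%:Z < j))/=; congr (_ + _).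
    by apply: eq_bigl => k; lia.
  have [jn|jn] := boolP (0 <= j <= n%:Z); last first.
    rewrite red_dist_supp// big_pred0// => k; have := ltn_ord k.
    by move: jn; lia.
  case: j jn => // j jn; have jn1 : (j < n.+1)%N by lia.
  rewrite (big_pred1 (Ordinal jn1))// => k /=.
  rewrite -(inj_eq val_inj)/=; lia.
have := int_taylor PhiS (dK n) (lattice_index n x)
  (lattice_index n (x + t) - lattice_index n x).
rewrite !cdfE addrCA subrr addr0.
set i := lattice_index n (x + t) - _; set h := lattice_step n.
have h0 : 0 < h by exact: lattice_step_gt0.
have ih : `|i%:~R * h - t| <= h.
  set ra := (x + t - red_u2 n 0 / w n) / h.
  set rb := (x - red_u2 n 0 / w n) / h.
  have -> : i%:~R * h - t = (i%:~R - (ra - rb)) * h.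
    by rewrite /ra /rb; field; rewrite !gt_eqF// urn_weight_gt0.
  rewrite normrM (gtr0_norm h0) ger_pMl// /i /lattice_index rmorphB/=.
  have := ceil_itv rb; have := ceil_itv ra; rewrite !rmorphB/= ler_norml.
  by rewrite -/ra -/rb; lra.
set g := p n _; set D := Phi n _ - _ => tay.
have /andP[g0 gK] : 0 <= g / h <= K.
  by rewrite ler_pdivrMr// pK andbT divr_ge0 ?red_dist_ge0// ltW.
have -> : D - t * (g / h) = D - i%:~R * g + (i%:~R * h - t) * (g / h).
  by field; rewrite gt_eqF.
apply: le_trans (ler_normD _ _) _; rewrite mulrDr; apply: lerD.
  apply: (le_trans tay); rewrite exprMn -mulrA -exprMn.
  rewrite (mulrC h) -(real_normK (num_real (_ * h))).
  apply: ler_pM; rewrite ?sqr_ge0//; first by rewrite lerDr.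
  rewrite ler_pXn2r ?nnegrE ?addr_ge0// ?(ltW h0)//.
  by rewrite -[X in `|X|](subrK t) (le_trans (ler_normD _ _))// addrC lerD2l.
rewrite normrM (ger0_norm g0) mulrC; apply: ler_pM => //.
by apply: (le_trans gK); rewrite lerDl sqr_ge0.
Qed.

Local Notation X := red_u2.
Local Notation law := red_law.
Local Notation h := lattice_step.

(** * Concentration around a growing mean *)

(** After the first draw both colours are present, since b and c are positive.
The values k = 0 and k = n are left out: they are impossible if the urn starts
with balls of only one colour. *)
Lemma red_dist_gt0 n k : (0 < k < n)%N -> 0 < p n k%:Z.
Proof.
have q_gt0 i l : (0 < i)%N -> 0 < q i l%:Z.
  move=> i0; rewrite divr_gt0 ?mulr_gt0 ?urn_size_gt0 ?urn_time_gt0//.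
  by rewrite -pmulrn -!natrM -!natrD ltr0n; nia.
have q_lt1 i l : (0 < i)%N -> (l <= i)%N -> 0 < 1 - q i l%:Z.
  move=> i0 li; rewrite red_probC// divr_gt0 ?mulr_gt0 ?urn_size_gt0 ?urn_time_gt0//.
  by rewrite ltr0z; nia.
have p0 i l : 0 <= p i l by exact: red_dist_ge0.
elim: n => [|n IH] in k *; first lia.
move=> /andP[k0 kn].
have -> : p n.+1 k%:Z = (1 - q n k%:Z) * p n k%:Z + q n (k.-1)%:Z * p n (k.-1)%:Z.
  by rewrite /red_dist/= /red_step add0n; congr (_ + q _ _ * red_law _ _ _ _); lia.
have [kn1|kn1] := ltnP k n.
  apply: ltr_wpDr; first by rewrite mulr_ge0// ltW// q_gt0//; lia.
  by rewrite mulr_gt0 ?IH ?q_lt1 ?k0//; lia.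
have [n2|n2] := ltnP 1 n.
  apply: ltr_wpDl; first by rewrite mulr_ge0// ltW// q_lt1//; lia.
  by rewrite mulr_gt0 ?IH ?q_gt0//; lia.
(* At time 2 there is no previous interior value: the mass at time 1 is shared
   by the values 0 and 1, and both lead to 1 with positive probability. *)
have [-> ->] : n = 1%N /\ k = 1%N by lia.
have := red_dist_mass 1.
rewrite 2!big_ord_recl big_ord0/= addr0 (_ : (bump 0 0)%:Z = 1)// => p1.
have q1 : 0 < 1 - q 1 1%N%:Z by apply: q_lt1.
have q0 : 0 < q 1 0%N%:Z by apply: q_gt0.
have [p00|p00] := ltP 0 (p 1 0).
  by apply: ltr_wpDl; [rewrite mulr_ge0// ltW|rewrite mulr_gt0].
by apply: ltr_wpDr; [rewrite mulr_ge0// ltW|rewrite mulr_gt0//; lra].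
Qed.

(** The trajectories through k0 at time n make up one part of the law at time
n + j. The remaining part solves the same recursion and is nonnegative at
time n, hence later. *)
Lemma red_law_le_dist n (k0 : int) j k :
  p n k0 * law n (fun k => (k == k0)%:R : R) j k <= p (n + j) k.
Proof.
have [kn|/red_dist_supp->//] := boolP (0 <= k0 <= n%:Z); last first.
  by rewrite mul0r; exact: red_dist_ge0.
pose gap i l := p (n + i) l - p n k0 * law n (fun k => (k == k0)%:R : R) i l.
suff [_ gap_ge0] : red_supp (n + j) (gap j) /\ forall l, 0 <= gap j l.
  by rewrite -subr_ge0; exact: gap_ge0.
elim: j => [|j [supp ge0]].
  rewrite /gap addn0/=; split=> l.
    move=> ln; rewrite red_dist_supp// (_ : _ == _ = false) ?mulr0 ?subr0//.
    by apply: contraNF ln => /eqP->.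
  by have [->|_] := eqVneq l k0; rewrite ?mulr1 ?subrr ?mulr0 ?subr0 ?red_dist_ge0.
have gapS l : gap j.+1 l = red_step (n + j) (gap j) l.
  by rewrite /gap addnS/= /red_dist/= add0n /red_step; ring.
split=> [l ln|l]; rewrite gapS; last exact: red_step_ge0.
by apply: red_supp_step => //; rewrite -addnS.
Qed.

(** Growth of the conditional mean of u2 between the times n and n + j. *)
Definition mean_growth n j : R := \prod_(i < j) (1 + s / y (n + i)).

Lemma mean_growthS n j :
  mean_growth n j.+1 = (1 + s / y (n + j)) * mean_growth n j.
Proof. by rewrite /mean_growth big_ord_recr/= mulrC. Qed.

Lemma mean_growth_ge n j : w (n + j) <= mean_growth n j * w n.
Proof.
elim: j => [|j IH]; first by rewrite addn0 /mean_growth big_ord0 mul1r.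
have y0 : 0 < y (n + j) by exact: urn_time_gt0.
have s01 : 0 < s < 1 by exact: sigma_itv.
rewrite addnS urn_timeS (le_trans (powR_succ_le s01 y0))//.
rewrite mean_growthS -[leRHS]mulrA [leLHS]mulrC ler_wpM2l//.
by case/andP: s01 => /ltW s0 _; rewrite addr_ge0// divr_ge0// ltW.
Qed.

(** Bounding the factors by ratios of powers of y - 1 instead of y reverses the
inequality of [mean_growth_ge]. The two bounds differ by a factor that tends
to 1 when n grows, whatever j is. *)
Lemma mean_growth_le n j : 1 < y n ->
  mean_growth n j * w n <= w (n + j) * (1 + (y n - 1)^-1).
Proof.
move=> yn; have s01 : 0 < s < 1 by exact: sigma_itv.
have [s0 s1] := andP s01.
have yj i : 1 < y (n + i).
  by rewrite (lt_le_trans yn)// urn_time_homo// leq_addr.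
have le_pred : mean_growth n j * (y n - 1) `^ s <= (y (n + j) - 1) `^ s.
  elim: j => [|j IH]; first by rewrite addn0 /mean_growth big_ord0 mul1r.
  rewrite addnS urn_timeS addrK (le_trans _ (powR_pred_le s01 (yj j)))//.
  rewrite mean_growthS -[leLHS]mulrA [leRHS]mulrC ler_wpM2l//.
  by rewrite addr_ge0// divr_ge0 ?(ltW s0)// ltW// (lt_trans ltr01).
have G0 : 0 <= mean_growth n j.
  apply: prodr_ge0 => i _.
  by rewrite addr_ge0// divr_ge0 ?(ltW s0)// ltW// (lt_trans ltr01).
have y1 : 0 < y n - 1 by rewrite subr_gt0.
have -> : y n = (y n - 1) * (1 + (y n - 1)^-1) by field; rewrite gt_eqF.
rewrite [X in _ <= _ * (1 + (X - 1)^-1)](_ : _ = y n); last by field; rewrite gt_eqF.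
have V0 : 0 <= (y n - 1)^-1 by rewrite invr_ge0 ltW.
rewrite powRM ?(ltW y1)// ?addr_ge0// mulrA; apply: ler_pM.
- by rewrite mulr_ge0// powR_ge0.
- exact: powR_ge0.
- apply: (le_trans le_pred); apply: ge0_ler_powR; rewrite ?nnegrE ?(ltW s0)//.
  + by rewrite subr_ge0 ltW.
  + by rewrite ltW// (lt_trans ltr01).
  + by rewrite gerBl.
- by apply: ler1_powR; rewrite ?lerDl// ltW.
Qed.

Local Notation e := ((b + c)%:R * s).

Lemma red_u2_next n k : X n.+1 k = X n k - c%:R * s.
Proof. by rewrite /red_u2 -natr1; ring. Qed.

Lemma red_u2_nextS n k : X n.+1 (k + 1) = X n k - c%:R * s + e.
Proof. by rewrite /red_u2 -natr1 rmorphD/=; ring. Qed.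

(** The mean increment of u2 at a draw is s / y times u2: the linear form u2 is an
eigenvector of the mean replacement, with eigenvalue m. *)
Lemma red_u2_drift n k : q n k * e = c%:R * s + s / y n * X n k.
Proof.
rewrite /red_prob /red_u2 /urn_time !natrD; field.
by rewrite -!(natrD, natrM) !pnatr_eq0; lia.
Qed.

(** Second moment of a variable with two values at distance e, split into its
squared mean and its variance. *)
Lemma red_u2_square_step n (k : int) (z : R) :
  (1 - q n k) * (X n.+1 k - (1 + s / y n) * z) ^+ 2
    + q n k * (X n.+1 (k + 1) - (1 + s / y n) * z) ^+ 2
  = (1 + s / y n) ^+ 2 * (X n k - z) ^+ 2 + q n k * (1 - q n k) * e ^+ 2.
Proof.
rewrite red_u2_next red_u2_nextS -exprMn.
have -> : (1 + s / y n) * (X n k - z) =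
  (X n k - c%:R * s - (1 + s / y n) * z) + q n k * e.
  by rewrite red_u2_drift; ring.
by ring.
Qed.

(** Let V be the left-hand side. A draw turns V into at most
(1 + s / y) ^ 2 V + m ^ 2, the variance of one increment being at most m ^ 2.
The bound A (G ^ 2 y_n - y), with G the growth of the mean, vanishes at time n
and dominates this recursion as soon as A (2 s - 1) >= m ^ 2, because
(1 + s / y) ^ 2 y - (y + 1) >= 2 s - 1. Such an A exists because s > 1/2. *)
Lemma red_law_variance n (f : int -> R) (x0 : R) : 2^-1 < s ->
  red_supp n f -> (forall k, 0 <= f k) -> \sum_(i < n.+1) f i%:Z = 1 ->
  \sum_(i < n.+1) f i%:Z * (X n i%:Z - x0) ^+ 2 = 0 ->
  forall j, \sum_(i < (n + j).+1)
      law n f j i%:Z * (X (n + j) i%:Z - mean_growth n j * x0) ^+ 2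
    <= m%:R ^+ 2 / (2 * s - 1) * (mean_growth n j ^+ 2 * y n - y (n + j)).
Proof.
move=> s2 supp f0 f1 var0; set A := _ / _.
have sA : 0 < 2 * s - 1 by move: s2; lra.
have A0 : 0 <= A by rewrite divr_ge0 ?sqr_ge0 ?(ltW sA).
have s01 : 0 < s < 1 by exact: sigma_itv.
have [s0 s1] := andP s01.
have em : e <= m%:R.
  rewrite mulrC mulrAC ler_pdivrMr ?urn_size_gt0// ler_wpM2l// ler_nat; lia.
have e0 : 0 <= e by rewrite mulr_ge0// ltW.
elim=> [|j IH].
  rewrite addn0 /= /mean_growth big_ord0 mul1r expr1n mul1r subrr mulr0.
  by rewrite var0.
have suppj : red_supp (n + j) (law n f j) by exact: red_supp_law.
have gej k : 0 <= law n f j k by exact: red_law_ge0.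
have y0 : 0 < y (n + j) by exact: urn_time_gt0.
rewrite addnS mean_growthS /=.
rewrite (red_step_sum
  (fun k => (X (n + j).+1 k - (1 + s / y (n + j)) * mean_growth n j * x0) ^+ 2)) //.
apply: le_trans (_ : \sum_(i < (n + j).+1) law n f j i%:Z *
   ((1 + s / y (n + j)) ^+ 2 * (X (n + j) i%:Z - mean_growth n j * x0) ^+ 2
    + m%:R ^+ 2) <= _).
  apply: ler_sum => i _; rewrite ler_wpM2l//.
  rewrite -(mulrA (1 + _) (mean_growth n j) x0) red_u2_square_step lerD2l.
  have /andP[q0 q1] : 0 <= q (n + j) i%:Z <= 1.
    by apply: red_prob_itv => //; rewrite -ltnS.
  apply: le_trans (_ : 1 * e ^+ 2 <= _).
    rewrite ler_wpM2r ?sqr_ge0// mulr_ile1// ?subr_ge0//.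
    by rewrite gerBl.
  by rewrite mul1r ler_pXn2r ?nnegrE.
under eq_bigr do rewrite mulrDr mulrCA.
rewrite big_split/= -mulr_sumr -mulr_suml.
rewrite (red_law_mass supp) f1 mul1r.
apply: le_trans (_ : (1 + s / y (n + j)) ^+ 2 *
  (A * (mean_growth n j ^+ 2 * y n - y (n + j))) + m%:R ^+ 2 <= _).
  by rewrite lerD2r ler_wpM2l ?sqr_ge0.
have -> : m%:R ^+ 2 = A * (2 * s - 1) by rewrite divfK// gt_eqF.
rewrite urn_timeS -subr_ge0.
have -> : A * (((1 + s / y (n + j)) * mean_growth n j) ^+ 2 * y n -
      (y (n + j) + 1)) -
   ((1 + s / y (n + j)) ^+ 2 * (A * (mean_growth n j ^+ 2 * y n - y (n + j))) +
    A * (2 * s - 1)) = A * (s ^+ 2 / y (n + j)).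
  by field; rewrite -!natrD !gt_eqF// ltr0n; lia.
by rewrite mulr_ge0// divr_ge0 ?sqr_ge0// ltW.
Qed.

Lemma urn_time_powR_large (t M : R) : 0 < t ->
  \forall n \near \oo, M <= y n `^ t.
Proof.
move=> t0; near=> n.
have M1 : 0 <= Num.max M 0 by rewrite le_max lexx orbT.
apply: (@le_trans _ _ ((Num.max M 0 `^ t^-1) `^ t)).
  by rewrite -powRrM mulVf ?gt_eqF// powRr1// le_max lexx.
apply: ge0_ler_powR; rewrite ?nnegrE ?powR_ge0 ?(ltW t0)//.
  by rewrite ltW// urn_time_gt0.
apply: le_trans (urn_time_ge _); rewrite //.
by near: n; exact: nbhs_infty_ger.
Unshelve. all: by end_near. Qed.

Lemma red_law_chebyshev n (k0 : int) j (eps : R) : 2^-1 < s -> 0 < eps ->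
  0 <= k0 <= n%:Z ->
  m%:R ^+ 2 / (2 * s - 1) * (mean_growth n j ^+ 2 * y n)
    <= (eps * w (n + j)) ^+ 2 / 2 ->
  2^-1 <= \sum_(k < (n + j).+1 |
      `|X (n + j) k%:Z - mean_growth n j * X n k0| < eps * w (n + j))
    law n (fun k => (k == k0)%:R : R) j k%:Z.
Proof.
move=> s2 eps0 kn small; set z := mean_growth n j * X n k0.
set f := fun k : int => (k == k0)%:R : R.
have supp : red_supp n f.
  by move=> k; rewrite /f; case: eqP => // ->; rewrite kn.
have f0 k : 0 <= f k by [].
case: k0 kn @f @z supp f0 => // k0 kn f z supp f0.
have k0n : (k0 < n.+1)%N by lia.
have sum_f (g : int -> R) : \sum_(i < n.+1) f i%:Z * g i%:Z = g k0%:Z.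
  rewrite (bigD1 (Ordinal k0n))//= /f eqxx mul1r big1 ?addr0// => i ik.
  rewrite (_ : _ == _ = false) ?mul0r//; apply: contraNF ik => /eqP[ik].
  exact/eqP/val_inj.
have f1 : \sum_(i < n.+1) f i%:Z = 1.
  by rewrite -[RHS](sum_f (fun=> 1)); apply: eq_bigr => i _; rewrite mulr1.
have v0 : \sum_(i < n.+1) f i%:Z * (X n i%:Z - X n k0%:Z) ^+ 2 = 0.
  by rewrite (sum_f (fun k => (X n k - X n k0%:Z) ^+ 2)) subrr expr0n.
have := red_law_variance s2 supp f0 f1 v0 j; rewrite -/z.
have mass := red_law_mass supp j.
rewrite f1 in mass; set A := _ / _ => var.
have A0 : 0 <= A by rewrite divr_ge0 ?sqr_ge0//; move: s2; lra.
have gej k : 0 <= law n f j k by exact: red_law_ge0.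
have ew : 0 < eps * w (n + j) by rewrite mulr_gt0// urn_weight_gt0.
set B := fun k : 'I_(n + j).+1 => `|X (n + j) k%:Z - z| < eps * w (n + j).
have tail : (eps * w (n + j)) ^+ 2 * \sum_(k < (n + j).+1 | ~~ B k) law n f j k%:Z
    <= (eps * w (n + j)) ^+ 2 / 2.
  apply: le_trans small.
  apply: le_trans (_ : A * (mean_growth n j ^+ 2 * y n - y (n + j)) <= _); last first.
    by rewrite ler_wpM2l// gerBl ltW// urn_time_gt0.
  apply: le_trans var; rewrite mulr_sumr [leRHS](bigID B)/= ler_wpDl//.
    by apply: sumr_ge0 => i _; rewrite mulr_ge0// sqr_ge0.
  apply: ler_sum => i; rewrite /B -leNgt => Bi; rewrite mulrC ler_wpM2l//.
  by rewrite -[leRHS]real_normK ?num_real// ler_pXn2r// nnegrE ltW.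
move: tail; rewrite ler_pM2l ?exprn_gt0// => tail.
by move: mass; rewrite (bigID B)/= -/f; move: tail; lra.
Qed.

(** The extreme values of u2 are linear in n with slopes of opposite signs, while
x y_n ^ s is negligible with respect to n. *)
Lemma lattice_index_inside (x : R) :
  \forall n \near \oo, 0 < lattice_index n x < n%:Z.
Proof.
have s01 : 0 < s < 1 by exact: sigma_itv.
have [s0 s1] := andP s01.
have S0 : 0 < S by exact: urn_size_gt0.
pose D : R := b%:R * al%:R - c%:R * be%:R.
pose tau : R := (al + be)%:R / S.
have tau0 : 0 <= tau by rewrite divr_ge0// ltW.
pose M : R := S * `|x| + `|D| + (b + c)%:R * m%:R * (tau + 1) + 1.
have M0 : 0 <= M by rewrite !addr_ge0// !mulr_ge0// ?addr_ge0// ltW.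
near=> n.
have w0 : 0 < w n by exact: urn_weight_gt0.
have w1 : 1 <= w n by near: n; exact: urn_time_powR_large.
have Mw : M * w n <= y n.
  apply: (@le_trans _ _ (y n `^ (1 - s) * w n)).
    rewrite ler_wpM2r ?(ltW w0)//.
    by near: n; apply: urn_time_powR_large; rewrite subr_gt0.
  rewrite -powRD; last by rewrite subrK oner_eq0.
  by rewrite subrK powRr1// ltW// urn_time_gt0.
have yE : y n = n%:R + tau by [].
have big : S * `|x| * w n + `|D| + (b + c)%:R * m%:R * (tau + 1) <= y n.
  have w_mul z : 0 <= z -> z <= z * w n by move=> z0; rewrite ler_peMr.
  apply: le_trans Mw; rewrite /M !mulrDl mul1r.
  apply: ler_wpDr; first exact: ltW.
  by rewrite !lerD// w_mul// !mulr_ge0// addr_ge0.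
have xw : `|S * x * w n| = S * `|x| * w n.
  by rewrite !normrM (gtr0_norm S0) (gtr0_norm w0).
have scale (r : nat) : (0 < r)%N -> y n <= r%:R * y n.
  by move=> r0; rewrite ler_peMl ?ler1n// ltW// urn_time_gt0.
have [cm bm] : (0 < c * m)%N /\ (0 < b * m)%N by rewrite !muln_gt0 b_gt0 c_gt0 m_gt0.
have := scale _ cm; have := scale _ bm; rewrite !natrM yE !mulrDr.
have cm0 : 0 < c%:R * m%:R :> R by rewrite mulr_gt0 ?ltr0n.
have bm0 : 0 <= b%:R * m%:R :> R by rewrite mulr_ge0.
have := mulr_ge0 (ltW cm0) tau0; have := mulr_ge0 bm0 tau0.
move: big; rewrite (natrD _ b c) -xw !mulrDl !mulrDr !mulr1.
have := ler_norm (S * x * w n); have := ler_norm (- (S * x * w n)).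
have := ler_norm D; have := ler_norm (- D); rewrite !normrN.
rewrite -red_u2_lt// ltr_pdivrMr// -(ltr_pM2l S0) mulVKf ?gt_eqF// (mulrA S x).
rewrite mulr0 addr0 -/D => D2 D1 x2 x1 big bt ct yb yc.
apply/andP; split.
  move: (S * x * w n) x1 x2 big => z x1 x2 big.
  by clear - yE D1 D2 x1 x2 big cm0 bm0 bt ct yb yc; lra.
rewrite -[X in _ < X](subrK 1) ltzD1 leNgt -red_u2_lt// -leNgt ler_pdivlMr//.
rewrite -(ler_pM2l S0) mulVKf ?gt_eqF// (mulrA S x).
rewrite rmorphB/= (natrD _ b c) -pmulrn mulrBr !mulrDl mulr1 -/D.
move: (S * x * w n) x1 x2 big => z x1 x2 big.
by clear - yE D1 D2 x1 x2 big cm0 bm0 bt ct yb yc; lra.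
Unshelve. all: by end_near. Qed.

(** The chain is restricted to the trajectories through one state k0 at a fixed
time n: large enough for the variance bound to be small and for the growth of
the mean to match that of y ^ s up to eps / 4, with k0 the first lattice point
that is not below x. *)
Lemma scaled_visits (x eps : R) : 2^-1 < s -> 0 < eps ->
  exists2 delta : R, 0 < delta & \forall n \near \oo,
    delta <= \sum_(k < n.+1 | `|X n k%:Z / w n - x| < eps) p n k%:Z.
Proof.
move=> s2 eps0.
have s01 : 0 < s < 1 by exact: sigma_itv.
have [s0 s1] := andP s01.
have w0 i : 0 < w i by exact: urn_weight_gt0.
have y0 i : 0 < y i by exact: urn_time_gt0.
pose A := m%:R ^+ 2 / (2 * s - 1).
have sA : 0 < 2 * s - 1 by move: s2; lra.
have A0 : 0 <= A by rewrite divr_ge0 ?sqr_ge0// ltW.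
(* K is such that (y n - 1)^-1, the relative error on the growth of the mean,
   times `|x| + eps is at most eps / 4. *)
pose K := (`|x| + eps) / (eps / 4) + 2.
have [n [yK [hn [[k0 [k0n [xk0 xk0']]] small]]]] : exists n, K <= y n /\
  lattice_step n <= eps / 4 /\
  (exists k0 : nat, (0 < k0 < n)%N /\ x <= X n k0%:Z / w n /\
     X n k0%:Z / w n <= x + lattice_step n) /\
  A * (2 ^+ 2 * y n) <= (eps / 2 * w n) ^+ 2 / 2.
  have ex1 : \forall n \near \oo, K <= (n%:R : R) by exact: nbhs_infty_ger.
  have ex2 := urn_time_powR_large ((eps / 4)^-1 * ((b + c)%:R * m%:R / S)) s0.
  have ex3 := lattice_index_inside x.
  have ex4 := urn_time_powR_large (32 * A / eps ^+ 2) sA.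
  have [N _ exN] := filterI (filterI ex1 ex2) (filterI ex3 ex4).
  have [[Kn wn] [/andP[kn0 kn] zl]] := exN N (leqnn N).
  move: N Kn wn kn0 kn zl {exN ex1 ex2 ex3 ex4} => n Kn wn kn0 kn zl.
  exists n; split; [|split; [|split]].
  - exact: le_trans Kn (urn_time_ge _).
  - by rewrite ler_pdivrMr// -ler_pdivrMl ?divr_gt0.
  - case E : (lattice_index n x) kn0 kn => [k|//] kn0 kn.
    have kx : ~~ (k%:Z < lattice_index n x) by rewrite E ltxx.
    have k1x : k%:Z - 1 < lattice_index n x by rewrite E ltrBlDr ltrDl.
    exists k; split; first by move: kn0 kn; rewrite !ltz_nat => -> ->.
    move: kx k1x; rewrite -!red_u2_lt// -leNgt => kx k1x; split=> //.
    apply: le_trans (_ : X n (k%:Z - 1) / w n + lattice_step n <= _).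
      by rewrite /red_u2 /lattice_step rmorphB/= le_eqVlt; apply/orP; left; apply/eqP; ring.
    by rewrite lerD2r ltW.
  (* The ratio of w n ^ 2 to y n is a positive power of y n, as s > 1/2. *)
  - have yy : y n * y n `^ (2 * s - 1) = w n ^+ 2.
      rewrite mulr_powRB1 ?(ltW (y0 n))//; last by lra.
      by rewrite -powR_mulrn ?powR_ge0// -powRrM mulrC.
    rewrite exprMn -yy.
    have -> : (eps / 2) ^+ 2 * (y n * y n `^ (2 * s - 1)) / 2 =
      (eps ^+ 2 * y n `^ (2 * s - 1)) / 8 * y n by field.
    rewrite (mulrA A) ler_wpM2r ?(ltW (y0 n))//.
    by move: zl; rewrite ler_pdivrMr ?exprn_gt0// (mulrC (eps ^+ 2)); lra.
exists (p n k0%:Z / 2); first by rewrite divr_gt0// red_dist_gt0.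
exists n => // N /= nN; have -> : N = (n + (N - n))%N by rewrite subnKC.
move: (N - n)%N => j {nN N}.
have KE : 2 <= y n.
  apply: le_trans yK; rewrite lerDr divr_ge0 ?addr_ge0 ?divr_ge0// ?(ltW eps0)//.
have yn1 : 1 < y n by rewrite (lt_le_trans _ KE)// ltr1n.
have ynV : (y n - 1)^-1 <= 1 by rewrite invf_le1; lra.
have Gle := mean_growth_le j yn1; have Gge := mean_growth_ge n j.
have G0 : 0 < mean_growth n j.
  by rewrite -(pmulr_lgt0 _ (w0 n)) (lt_le_trans (w0 (n + j)%N)).
have cheb : 2^-1 <= \sum_(k < (n + j).+1 |
      `|X (n + j) k%:Z - mean_growth n j * X n k0%:Z| < eps / 2 * w (n + j))
    law n (fun k => (k == k0%:Z)%:R : R) j k%:Z.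
  have k0n' : 0 <= k0%:Z <= n%:Z by rewrite lez_nat; case/andP: k0n => _ /ltnW.
  apply: red_law_chebyshev; [by []|by rewrite divr_gt0|by []|].
  rewrite -/A -(ler_pM2r (exprn_gt0 2 (w0 n))).
  apply: le_trans (_ : A * (2 ^+ 2 * y n) * w (n + j) ^+ 2 <= _).
    have Gw : mean_growth n j * w n <= 2 * w (n + j).
      by rewrite (le_trans Gle)// mulrC ler_wpM2r ?(ltW (w0 _))//; lra.
    have -> : A * (mean_growth n j ^+ 2 * y n) * w n ^+ 2 =
      A * y n * (mean_growth n j * w n) ^+ 2 by ring.
    have -> : A * (2 ^+ 2 * y n) * w (n + j) ^+ 2 = A * y n * (2 * w (n + j)) ^+ 2.
      by ring.
    have Ay0 : 0 <= A * y n by rewrite mulr_ge0// ltW.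
    apply: (ler_wpM2l Ay0); rewrite ler_pXn2r// nnegrE mulr_ge0// ltW//.
  have -> : (eps / 2 * w (n + j)) ^+ 2 / 2 * w n ^+ 2 =
    (eps / 2 * w n) ^+ 2 / 2 * w (n + j) ^+ 2 by ring.
  by rewrite ler_wpM2r ?sqr_ge0.
rewrite -mulrC; apply: le_trans (ler_wpM2r _ cheb) _; first exact: red_dist_ge0.
rewrite mulrC mulr_sumr.
apply: le_trans (_ : \sum_(k < (n + j).+1 |
      `|X (n + j) k%:Z - mean_growth n j * X n k0%:Z| < eps / 2 * w (n + j))
    p (n + j) k%:Z <= _).
  by apply: ler_sum => k _; exact: red_law_le_dist.
rewrite big_mkcond [leRHS]big_mkcond/=; apply: ler_sum => k _.
have pk : 0 <= p (n + j) k%:Z by exact: red_dist_ge0.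
have wN := w0 (n + j)%N.
case: ifPn => [near|_]; last by case: ifP.
rewrite ifT//.
(* u is the starting point and g the drift of the rescaled mean. *)
pose u := X n k0%:Z / w n; pose g := mean_growth n j * w n / w (n + j).
have uE : X n k0%:Z = u * w n by rewrite divfK// gt_eqF.
have gE : mean_growth n j * X n k0%:Z = g * u * w (n + j).
  by rewrite uE /g; field; rewrite gt_eqF.
have g1 : 1 <= g by rewrite ler_pdivlMr// mul1r.
have g2 : g <= 1 + (y n - 1)^-1 by rewrite ler_pdivrMr// [leRHS]mulrC.
have u1 : `|u - x| <= eps / 4.
  by rewrite ger0_norm ?subr_ge0// lerBlDl (le_trans xk0')// lerD2l.
clearbody u g.
have gu : `|(g - 1) * u| <= eps / 4.
  have yK' : (`|x| + eps) / (eps / 4) <= y n - 1.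
    by rewrite lerBrDr (le_trans _ yK)// /K lerD2l ler1n.
  have e4 : 0 < eps / 4 by rewrite divr_gt0.
  rewrite normrM; apply: le_trans (_ : (y n - 1)^-1 * (`|x| + eps) <= _).
    apply: ler_pM => //; first by rewrite ger0_norm ?subr_ge0// lerBlDl.
    have := ler_normD (u - x) x; rewrite subrK; move: u1 eps0; lra.
  rewrite mulrC ler_pdivrMr ?subr_gt0// mulrC -ler_pdivrMr//.
rewrite gE in near.
have -> : X (n + j) k%:Z / w (n + j) - x =
    (X (n + j) k%:Z - g * u * w (n + j)) / w (n + j) + ((g - 1) * u + (u - x)).
  by field; rewrite gt_eqF.
apply: le_lt_trans (ler_normD _ _) _.
have near' : `|(X (n + j) k%:Z - g * u * w (n + j)) / w (n + j)| < eps / 2.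
  by rewrite normrM normfV (gtr0_norm wN) ltr_pdivrMr.
have := ler_normD ((g - 1) * u) (u - x); move: near' u1 gu; lra.
Qed.

(** * The density and the support of the limit *)

Context d0 (T : measurableType d0) (P : probability T R).
Context (U : nat -> {RV P >-> (nat * nat)%type}).
Context (urnU : is_urn_process (c + m) b c (b + m) al be U).

Definition scaled_urn (n : nat) (t : T) : R :=
  urn_u2 R (c + m) b c (U n t) / w n.

Lemma measurable_scaled_urn n : measurable_fun [set: T] (scaled_urn n).
Proof.
move=> _ B mB; rewrite setTI.
rewrite (_ : _ @^-1` _ =
  U n @^-1` [set u | B (urn_u2 R (c + m) b c u / w n)])//.
by apply: measurable_funPTI; exact: measurable_natpair.
Qed.

Lemma scaled_urn_law n (V : set R) (B : pred R) :
  measurable V -> (forall z, V z <-> B z) ->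
  fine (P (scaled_urn n @^-1` V)) = \sum_(k < n.+1 | B (X n k%:Z / w n)) p n k%:Z.
Proof.
move=> mV VB.
have mpre : measurable (scaled_urn n @^-1` V).
  by rewrite -[_ @^-1` _]setTI; exact: measurable_scaled_urn.
have plaw (k : 'I_n.+1) :
    P (U n @^-1` [set red_comp n k]) = (p n k%:Z)%:E.
  by apply: urn_process_law => //; rewrite -ltnS.
have compI : injective (fun k : 'I_n.+1 => red_comp n k).
  by move=> i j /red_comp_inj; exact: val_inj.
rewrite (measure_finite_support compI plaw)//; last exact: red_dist_mass.
rewrite (eq_bigr (fun k : 'I_n.+1 =>
    (if B (X n k%:Z / w n) then p n k%:Z else 0)%:E)).
  by rewrite sumEFin /= -big_mkcond.
move=> k _; have kn : (k <= n)%N by rewrite -ltnS.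
case: ifPn => Bk.
  rewrite -plaw; congr (P _); apply/seteqP; split=> [t []//|t Ut]; split=> //=.
  by rewrite /scaled_urn Ut urn_u2_comp//; exact/VB.
rewrite (_ : _ `&` _ = set0) ?measure0//; apply/seteqP; split=> // t [/= Vt Ut].
by move: Vt; rewrite /scaled_urn Ut urn_u2_comp// => /VB; exact/negP.
Qed.

Lemma lattice_step_cvg0 : h n @[n --> \oo] --> 0.
Proof.
have /andP[s0 _] : 0 < s < 1 by exact: sigma_itv.
apply/cvgr0Pnorm_le => e e0; near=> n.
have w0 : 0 < w n by exact: urn_weight_gt0.
have h0 : 0 < h n by exact: lattice_step_gt0.
rewrite (gtr0_norm h0) ler_pdivrMr// -ler_pdivrMl//.
by near: n; exact: urn_time_powR_large.
Unshelve. all: by end_near. Qed.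

(** Between n / y_n and 1, because 0 < s < 1. *)
Lemma time_ratio_cvg1 : (n%:R `^ s) / w n @[n --> \oo] --> (1 : R).
Proof.
have s01 : 0 < s < 1 by exact: sigma_itv.
have [s0 s1] := andP s01.
have ratio : 1 - (al + be)%:R / S / y n @[n --> \oo] --> (1 : R).
  rewrite -[X in _ --> X]subr0; apply: cvgB; first exact: cvg_cst.
  apply/cvgr0Pnorm_le => e e0; near=> n.
  have y0 : 0 < y n by exact: urn_time_gt0.
  rewrite ger0_norm ?divr_ge0 ?(ltW y0)// ler_pdivrMr// -ler_pdivrMl//.
  apply: le_trans (urn_time_ge _).
  by near: n; exact: nbhs_infty_ger.
have one : (fun=> 1 : R) @ \oo --> (1 : R) by exact: cvg_cst.
apply: (squeeze_cvgr _ ratio one); near=> n.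
have n0 : (0 < n)%N by near: n; exists 1%N.
have y0 : 0 < y n by exact: urn_time_gt0.
have w0 : 0 < w n by exact: urn_weight_gt0.
have ny : n%:R <= y n by exact: urn_time_ge.
have -> : 1 - (al + be)%:R / S / y n = n%:R / y n.
  have -> : n%:R = y n - (al + be)%:R / S by rewrite /urn_time addrK.
  by rewrite mulrBl divff// gt_eqF.
apply/andP; split; last first.
  rewrite ler_pdivrMr// mul1r; apply: ge0_ler_powR; rewrite ?nnegrE ?(ltW s0)//.
  exact: ltW.
have -> : n%:R `^ s / w n = (n%:R / y n) `^ s.
  rewrite powRM ?invr_ge0 ?(ltW y0)// -[in RHS](powR_inv1 (ltW y0)) powRAC.
  by rewrite powR_inv1 ?(ltW w0).
apply: ger1_powR; last exact: ltW.
by rewrite divr_gt0 ?ltr0n//= ler_pdivrMr// mul1r.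
Unshelve. all: by end_near. Qed.

Context (W : {RV P >-> R}).
Context (limW : is_urn_limit (c + m) b c U W).

Lemma scaled_urn_cvg : {ae P, forall t, scaled_urn n t @[n --> \oo] --> W t}.
Proof.
apply: filterS limW => t Wt.
rewrite -[X in _ --> X]mul1r.
apply: cvg_trans (cvgM time_ratio_cvg1 Wt); apply: near_eq_cvg; near=> n.
have n0 : 0 < n%:R :> R by rewrite ltr0n; near: n; exists 1%N.
have w0 : 0 < w n by exact: urn_weight_gt0.
rewrite /scaled_urn urn_sigmaE /=; field.
by rewrite !gt_eqF// powR_gt0.
Unshelve. all: by end_near. Qed.

(** The open set is also given by a boolean predicate, which the sum needs. *)
Lemma scaled_urn_near (V : set R) (B : pred R) (e : R) :
  open V -> (forall z, V z <-> B z) -> 0 < e ->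
  \forall n \near \oo, fine (P (W @^-1` V)) - e
    <= \sum_(k < n.+1 | B (X n k%:Z / w n)) p n k%:Z.
Proof.
move=> oV VB e0.
have := open_portmanteau measurable_scaled_urn _ scaled_urn_cvg oV e0.
move=> /(_ (measurable_funPT W)); apply: filterS => n.
by rewrite (scaled_urn_law n _ VB)//; exact: open_measurable.
Qed.

(** The points at distance more than eps / 2 from x form an open set, from which
the rescaled urn keeps away with probability at least delta. *)
Lemma support_urn_limit : 2^-1 < s -> measure_support (distribution P W) = [set: R].
Proof.
move=> s2; apply/seteqP; split=> // x _ V oV Vx.
have [eps /= eps0 epsV] : nbhs_ball x V.
  by apply/nbhs_ballP; exact: open_nbhs_nbhs.
have e2 : 0 < eps / 2 by rewrite divr_gt0.
have [delta d_gt0 visits] := scaled_visits x s2 e2.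
pose A : set R := [set z | eps / 2 < `|z - x|].
have oA : open A.
  rewrite (_ : A = (fun z => `|z - x|) @^-1` [set r | eps / 2 < r])//.
  apply: open_comp; last exact: open_gt.
  by move=> z _; apply: cvg_norm; apply: cvgB; [exact: cvg_id|exact: cvg_cst].
have hd : 0 < delta / 2 by rewrite divr_gt0.
have far := @scaled_urn_near A (fun z => eps / 2 < `|z - x|) _ oA (fun=> iff_refl _) hd.
have [N _ both] := filterI visits far.
have [/= near_x far_x] := both N (leqnn N).
have mass := red_dist_mass N.
have PA : fine (P (W @^-1` A)) <= 1 - delta / 2.
  rewrite (bigID (fun k : 'I_N.+1 => `|X N k%:Z / w N - x| < eps / 2))/= in mass.
  have : \sum_(k < N.+1 | eps / 2 < `|X N k%:Z / w N - x|) p N k%:Z <=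
      \sum_(k < N.+1 | ~~ (`|X N k%:Z / w N - x| < eps / 2)) p N k%:Z.
    apply: sum_subset_le => k; first by rewrite -leNgt => /ltW.
    exact: red_dist_ge0.
  by move: near_x far_x mass; lra.
have mA : measurable (W @^-1` A) by apply: measurable_funPTI; exact: open_measurable.
apply: lt_le_trans (_ : P (~` (W @^-1` A)) <= _)%E.
  rewrite probability_setC// -(@fineK _ (P (W @^-1` A))) ?fin_num_measure//.
  by rewrite -EFinB lte_fin; move: PA hd; lra.
apply: le_measure; rewrite ?inE//.
- exact: measurableC.
- by apply: measurable_funPTI; exact: open_measurable.
move=> t /= /negP; rewrite -leNgt => Wt; apply: epsV.
by rewrite /ball/= distrC (le_lt_trans Wt)// ltr_pdivrMr// ltr_pMr// ltr1n.
Qed.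

Let mP (V : set R) : measurable V -> measurable (W @^-1` V).
Proof. by move=> mV; exact: measurable_funPTI. Qed.

(** An interval of radius e has mass O(e) for the rescaled urn at all large times,
by the uniform expansions, hence for the limit. *)
Lemma urn_limit_no_atom x : P (W @^-1` [set x]) = 0%E.
Proof.
have [C C0 [phi phiC expand]] := scaled_cdf_expand.
have mx : measurable (W @^-1` [set x]) by apply: mP; exact: measurable_set1.
have small e : 0 < e <= 1 -> fine (P (W @^-1` [set x])) <= e * (1 + 12 * C).
  move=> /andP[e0 e1].
  pose V := [set z : R | x - e < z < x + e].
  have oV : open V.
    rewrite (_ : V = [set z | x - e < z] `&` [set z | z < x + e]).
      by apply: openI; [exact: open_gt|exact: open_lt].
    by apply/seteqP; split=> z /= => [/andP|zV]; last exact/andP.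
  have near1 := @scaled_urn_near V (fun z => x - e < z < x + e) _ oV (fun=> iff_refl _) e0.
  have near2 : \forall n \near \oo, `|0 - h n| <= e.
    by move/cvgrPdist_le : lattice_step_cvg0; exact.
  have [N _ both] := filterI near1 near2.
  have [/= PV] := both N (leqnn N).
  have h0 : 0 < h N by exact: lattice_step_gt0.
  rewrite sub0r normrN (gtr0_norm h0) => hN.
  have xV : fine (P (W @^-1` [set x])) <= fine (P (W @^-1` V)).
    rewrite fine_le ?fin_num_measure//; last first.
      rewrite le_measure ?inE//; first by apply: mP; exact: open_measurable.
      by move=> t /= ->; rewrite /V/= ltrBlDr ltrDl e0.
    by apply: mP; exact: open_measurable.
  have := expand N (x - e) (2 * e).
  have -> : x - e + 2 * e = x + e by ring.
  have /andP[phi0 phi1] := phiC N (x - e).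
  have : scaled_cdf N (x - e) + \sum_(k < N.+1 | x - e < X N k%:Z / w N < x + e) p N k%:Z
      <= scaled_cdf N (x + e).
    rewrite /scaled_cdf [leRHS](bigID (fun k : 'I_N.+1 => X N k%:Z / w N < x - e))/=.
    apply: lerD; apply: sum_subset_le => k; rewrite ?red_dist_ge0//.
      by move=> lt; rewrite lt (lt_trans lt)// ltrBlDr -addrA ltrDl addr_gt0.
    by case/andP => gt ->; rewrite -leNgt ltW.
  rewrite (gtr0_norm (_ : 0 < 2 * e)) ?mulr_gt0// => split_cdf.
  move/(le_trans (ler_norm _)) => bound.
  have tphi : 2 * e * phi N (x - e) <= 2 * e * C by rewrite ler_wpM2l// mulr_ge0// ltW.
  have bound2 : C * ((2 * e + h N) ^+ 2 + h N) <= C * (9 * e + e).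
    rewrite ler_wpM2l// lerD// (le_trans (_ : _ <= (3 * e) ^+ 2))//.
      by rewrite ler_pXn2r// ?nnegrE; move: hN h0 e0; lra.
    have -> : (3 * e) ^+ 2 = 9 * e * e by ring.
    by rewrite ler_piMr// mulr_ge0// ltW.
  by move: PV xV split_cdf bound tphi bound2; lra.
apply/eqP; rewrite -(@fineK _ (P _)) ?fin_num_measure// eqe.
rewrite eq_le fine_ge0// andbT; apply/ler_addgt0Pr => e e0; rewrite add0r.
have C1 : 0 < 1 + 12 * C by rewrite ltr_pwDl// mulr_ge0.
have := small (Num.min 1 (e / (1 + 12 * C))).
rewrite lt_min ltr01 divr_gt0//= ge_min lexx/= => /(_ isT)/le_trans; apply.
by rewrite -ler_pdivlMr// ge_min lexx orbT.
Qed.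

Let F x := fine (P (W @^-1` [set z | z <= x])).

Lemma urn_limit_cdf_lt x : fine (P (W @^-1` [set z | z < x])) = F x.
Proof.
have mlt : measurable (W @^-1` [set z | z < x]).
  by apply: mP; apply: open_measurable; exact: open_lt.
have mle : measurable (W @^-1` [set z | z <= x]).
  by apply: mP; apply: closed_measurable; exact: closed_le.
have mx : measurable (W @^-1` [set x]) by apply: mP; exact: measurable_set1.
rewrite /F; congr fine; apply/eqP; rewrite eq_le; apply/andP; split.
  by apply: le_measure; rewrite ?inE// => t /= /ltW.
rewrite -[leRHS]adde0 -(urn_limit_no_atom x).
apply: le_trans (measureU2 _ _ _) => //.
apply: le_measure; rewrite ?inE//; first exact: measurableU.
by move=> t /=; rewrite le_eqVlt => /predU1P[->|]; [right|left].
Qed.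

(** The two open half-lines at x have total mass 1 because x is not an atom, so
that the lower bounds on their masses are also upper bounds. *)
Lemma scaled_cdf_cvg x : scaled_cdf n x @[n --> \oo] --> F x.
Proof.
apply/cvgrPdist_le => e e0.
have near1 := @scaled_urn_near [set z | z < x] (fun z => z < x) _
  (@open_lt R x) (fun=> iff_refl _) e0.
have near2 := @scaled_urn_near [set z | x < z] (fun z => x < z) _
  (@open_gt R x) (fun=> iff_refl _) e0.
apply: filterS2 near1 near2 => n /=.
rewrite urn_limit_cdf_lt -/(scaled_cdf n x) => lo.
have mle : measurable (W @^-1` [set z | z <= x]).
  by apply: mP; apply: closed_measurable; exact: closed_le.
have -> : W @^-1` [set z | x < z] = ~` (W @^-1` [set z | z <= x]).
  by apply/seteqP; split => t /=; rewrite ltNge => /negP.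
rewrite probability_setC// fineB ?fin_num_measure//= -/(F x).
have := red_dist_mass n.
rewrite (bigID (fun k : 'I_n.+1 => X n k%:Z / w n < x))/= -/(scaled_cdf n x).
have : \sum_(k < n.+1 | x < X n k%:Z / w n) p n k%:Z <=
   \sum_(k < n.+1 | ~~ (X n k%:Z / w n < x)) p n k%:Z.
  apply: sum_subset_le => k; first by rewrite -leNgt => /ltW.
  exact: red_dist_ge0.
by move: lo; rewrite ler_norml; lra.
Qed.

Lemma density_urn_limit : exists f : R -> R,
  [/\ is_density (distribution P W) f, bounded_fun f & continuous f].
Proof.
have [C C0 [phi phiC expand]] := scaled_cdf_expand.
have [f [fC Ff]] := limit_quadratic_approx lattice_step_cvg0 phiC expand scaled_cdf_cvg.
have fcont := lipschitz_continuous (quadratic_approx_lipschitz Ff).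
exists f; split=> //.
- apply: (@is_density_of_derive R (distribution P W : probability R R) F f) => //.
  + by move=> x; case/andP: (fC x).
  + exact: quadratic_approx_derive Ff.
  + move=> x z xz; have mle r : measurable (W @^-1` [set z | z <= r]).
      by apply: mP; apply: closed_measurable; exact: closed_le.
    transitivity (P ((W @^-1` [set u | u <= z]) `\` (W @^-1` [set u | u <= x]))).
      rewrite /= /distribution /pushforward; congr (P _).
      apply/seteqP; split => t /=; rewrite in_itv/=.
        by case/andP => xt tz; split=> //; apply/negP; rewrite -ltNge.
      by case=> tz /negP; rewrite -ltNge => ->.
    rewrite measureD ?setIidr//; last first.
    * by rewrite -ge0_fin_numE// fin_num_measure.
    * by move=> t /= tx; rewrite (le_trans tx)// ltW.
    by rewrite EFinB !fineK ?fin_num_measure.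
- exists C; split; first exact: num_real.
  move=> M CM x _ /=; have /andP[f0 f1] := fC x.
  by rewrite ger0_norm// (le_trans f1)// ltW.
Qed.

End BalancedUrn.

Unset Implicit Arguments.

Theorem corollary1 (R : realType) (a b c d : nat)
  (balanced : (a + b = c + d)%N)
  (nontriangular : (b * c)%N <> 0%N)
  (large : 2%:R^-1 < urn_sigma R a b c)
  (alpha beta : nat) (nonempty : (alpha, beta) <> (0%N, 0%N))
  (d0 : measure_display) (T : measurableType d0) (P : probability T R)
  (U : nat -> {RV P >-> (nat * nat)%type})
  (urnU : is_urn_process a b c d alpha beta U)
  (W : {RV P >-> R}) (limW : is_urn_limit a b c U W) :
  (exists f : R -> R,
     [/\ is_density (distribution P W) f, bounded_fun f & continuous f]) /\
  measure_support (distribution P W) = [set: R].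
Proof.
have [b0 c0] : (0 < b)%N /\ (0 < c)%N by move: nontriangular; nia.
have ca : (c < a)%N.
  rewrite -(ltr_nat R) -subr_gt0.
  have ab : 0 < (a + b)%:R :> R by rewrite ltr0n addn_gt0 b0 orbT.
  have : 0 < urn_sigma R a b c by rewrite (lt_trans _ large)// invr_gt0.
  by rewrite /urn_sigma pmulr_lgt0 ?invr_gt0.
pose m := (a - c)%N; have m0 : (0 < m)%N by rewrite subn_gt0.
have aE : a = (c + m)%N by rewrite subnKC// ltnW.
have dE : d = (b + m)%N by move: balanced; rewrite aE; lia.
have init : (0 < alpha + beta)%N.
  by rewrite lt0n addn_eq0; apply/negP => /andP[/eqP u /eqP v]; apply: nonempty; rewrite u v.
move: m m0 aE dE => m m0 aE dE; subst a d.
have s2 : 2^-1 < m%:R / (b + c + m)%:R :> R.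
  by rewrite -urn_sigmaE.
split; first exact: density_urn_limit urnU _ limW.
exact: support_urn_limit urnU _ limW s2.
Qed.
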